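(* Let $p$ be an odd prime. (i) If $p\neq5$, then $$\sum_{k=1}^{p-1}(-1)^k\frac{\binom{2k}{k}}{k}\equiv-5\,\frac{F_{p-\left(\frac p5\right)}}{p}\pmod p,$$ $$\sum_{k=1}^{p-1}(-1)^k\frac{\binom{2k}{k}}{k\,5^k}\equiv q_p(5)-6\,\frac{F_{p-\left(\frac p5\right)}}{p}\pmod p,$$ $$\sum_{k=1}^{p-1}\frac{\binom{2k}{k}}{k\,5^k}\equiv q_p(5)-\frac{F_{p-\left(\frac p5\right)}}{p}\pmod p.$$ (ii) One has $$\sum_{k=1}^{p-1}(-1)^k\frac{\binom{2k}{k}}{k\,4^k}\equiv 2q_p(2)-4\,\frac{P_{p-\left(\frac 2p\right)}}{p}\equiv2\sum_{0<k<3p/4}\frac{(-1)^{k-1}}{k}\pmod p.$$ (iii) If $p>3$, then $$\sum_{k=1}^{p-1}(-1)^k\frac{\binom{2k}{k}}{k\,2^{k}}\equiv q_p(2)-6\left(\frac 2p\right)\frac{S_{\left(p-\left(\frac 3p\right)\right)/2}}{p}\equiv\sum_{0<k<5p/6}\frac{(-1)^{k-1}}{k}\pmod p$$ and $$\sum_{k=1}^{p-1}\frac{\binom{2k}{k}}{k\,6^k}\equiv q_p(2)+q_p(3)-2\left(\frac 2p\right)\frac{S_{\left(p-\left(\frac 3p\right)\right)/2}}{p}\pmod p.$$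
   Context: $\left(\frac{\cdot}{\cdot}\right)$ is the Jacobi (Legendre) symbol. For a prime $p$ and an integer $a$ not divisible by $p$, $q_p(a)$ denotes the integer $(a^{p-1}-1)/p$. The Fibonacci numbers are $F_0=0$, $F_1=1$, $F_{n+1}=F_n+F_{n-1}$ ($n\ge1$). The Pell numbers are $P_0=0$, $P_1=1$, $P_{n+1}=2P_n+P_{n-1}$ ($n\ge1$). The sequence $\{S_n\}_{n\ge0}$ is defined by $S_0=0$, $S_1=1$, $S_{n+1}=4S_n-S_{n-1}$ ($n\ge1$). Sums over $0<k<3p/4$ and $0<k<5p/6$ run over integers $k$. Congruences modulo $p$ between rational numbers are understood in the ring of rational numbers whose denominator is prime to $p$. *)

(* Defs.v *)
From mathcomp Require Import all_boot all_order all_algebra.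

Set Implicit Arguments.
Unset Strict Implicit.
Unset Printing Implicit Defensive.

Import Order.TTheory GRing.Theory Num.Theory.
Local Open Scope ring_scope.

(* Rationals whose denominator is prime to p, as a subset of rat. *)
Definition pintegral (p : nat) (x : rat) : bool := coprime p `|denq x|%N.

(* Congruence modulo p in the ring of pintegral rationals; membership of both
   sides in that ring is part of the assertion. *)
Definition ratcong (p : nat) (x y : rat) : Prop :=
  [/\ pintegral p x, pintegral p y &
      exists2 z : rat, pintegral p z & x - y = p%:R * z].

(* Meant for p an odd prime. *)
Definition legendre (a : int) (p : nat) : int :=
  if (p%:Z %| a)%Z then 0
  else if [exists x : 'I_p, ((x%:Z) ^+ 2 == a %[mod p%:Z])%Z] then 1
  else -1.

(* Meant for n odd and positive. *)
Definition jacobi (a : int) (n : nat) : int :=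
  \prod_(f <- prime_decomp n) legendre a f.1 ^+ f.2.

(* Rational division, so nothing is rounded; the value is an integer when p is
   a prime not dividing a. *)
Definition fermat_quotient (p : nat) (a : int) : rat :=
  (a%:~R ^+ p.-1 - 1) / p%:R.

Fixpoint fib (n : nat) : nat :=
  match n with
  | 0 => 0
  | 1 => 1
  | (m.+1 as n').+1 => fib n' + fib m
  end%N.

Fixpoint pell (n : nat) : nat :=
  match n with
  | 0 => 0
  | 1 => 1
  | (m.+1 as n').+1 => 2 * pell n' + pell m
  end%N.

Fixpoint seqS (n : nat) : int :=
  match n with
  | 0%N => 0
  | 1%N => 1
  | (m.+1 as n').+1 => 4 * seqS n' - seqS m
  end.

(* Main.v *)
(* Write the congruences in the ring of algebraic numbers that are integral at
   p.  If x^p is congruent to a unit y modulo p, put lq x y = (x^p / y - 1) / p;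
   modulo p this quotient is additive in the pair (x, y), and lq a a is the
   Fermat quotient of an integer a.

   - Let a, b be the roots of X^2 - m X + m.  Waring's formula for a^p + b^p has
     k-th coefficient p/k binom(p-k-1, k-1) up to sign, and 2 binom(p-k-1, k-1)
     is +- binom(2k, k) modulo p, so sum binom(2k, k) / (k m^k) is congruent to
     2 (m^p - a^p - b^p) / (p m), a combination of lq's of a, b and m.
   - For m = -1, 5, -5, -4, -2, 6 the roots are products of rational integers,
     square roots of 5, 2, 3 and the units (1 + sqrt 5)/2, 1 + sqrt 2,
     1 + sqrt 3 (a unit at p, of norm -2).  The difference of the lq's of such a
     unit and of its conjugate is the quotient F/p, P/p or S/p up to a factor.
   - For d = 4 or 6, binom(p, j)/p = (-1)^(j-1)/j modulo p turns the sum over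
     k < p/d of (-1)^(k-1)/k into (sum of (1 + x)^p over x^d = -1, minus d) / p,
     and (1 + x)(1 + 1/x) = 2 + (x + 1/x) expresses lq (1 + x) by the same
     units. *)
Require Import Defs.
From mathcomp Require Import all_boot all_order all_algebra.
From mathcomp Require Import all_fingroup all_solvable all_field ring zify.

Set Implicit Arguments.
Unset Strict Implicit.
Unset Printing Implicit Defensive.

Import Order.TTheory GRing.Theory Num.Theory.
Local Open Scope ring_scope.

(** * Congruences between algebraic numbers integral at p *)

(** The ring of algebraic integers localised at the integers prime to [p]. It is not local, so units
    are handled through an explicit inverse in the ring. *)
Definition pint (p : nat) (x : algC) : Prop :=
  exists2 n : nat, coprime p n & n%:R * x \in Aint.

(** The modulus is the ideal generated by [p], not a prime above it; [x] and [y] themselves may fail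
    to be integral. *)
Definition cong (p : nat) (x y : algC) : Prop := pint p ((x - y) / p%:R).

(* Only meaningful when [x ^+ p] is congruent to the unit [y] modulo [p]. *)
Definition lq (p : nat) (x y : algC) : algC := (x ^+ p / y - 1) / p%:R.

Lemma natr_prime_neq0 p : prime p -> p%:R != 0 :> algC.
Proof. by move=> pp; rewrite pnatr_eq0 -lt0n prime_gt0. Qed.

Section Localization.
Variable p : nat.

Lemma pint_Aint x : x \in Aint -> pint p x.
Proof. by exists 1%N; rewrite ?coprimen1 ?mul1r. Qed.

Lemma pint_nat n : pint p n%:R.
Proof. exact/pint_Aint/rpred_nat. Qed.

Lemma pint_int n : pint p n%:~R.
Proof. exact/pint_Aint/rpred_int. Qed.

Lemma pint0 : pint p 0. Proof. exact: (pint_nat 0). Qed.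
Lemma pint1 : pint p 1. Proof. exact: (pint_nat 1). Qed.

Lemma pintD x y : pint p x -> pint p y -> pint p (x + y).
Proof.
case=> m cm mx [n cn ny]; exists (m * n)%N; first by rewrite coprimeMr cm.
have -> : (m * n)%:R * (x + y) = n%:R * (m%:R * x) + m%:R * (n%:R * y).
  by rewrite natrM; ring.
by apply: rpredD; apply: rpredM => //; apply: rpred_nat.
Qed.

Lemma pintN x : pint p x -> pint p (- x).
Proof. by case=> m cm mx; exists m => //; rewrite mulrN rpredN. Qed.

Lemma pintB x y : pint p x -> pint p y -> pint p (x - y).
Proof. by move=> px py; apply: pintD => //; apply: pintN. Qed.

Lemma pintM x y : pint p x -> pint p y -> pint p (x * y).
Proof.
case=> m cm mx [n cn ny]; exists (m * n)%N; first by rewrite coprimeMr cm.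
have -> : (m * n)%:R * (x * y) = (m%:R * x) * (n%:R * y) by rewrite natrM; ring.
exact: rpredM.
Qed.

Lemma pintX x n : pint p x -> pint p (x ^+ n).
Proof.
move=> px; elim: n => [|n IH]; rewrite ?expr0 ?exprS; first exact: pint1.
exact: pintM.
Qed.

Lemma pint_sum (I : eqType) (r : seq I) (P : pred I) (f : I -> algC) :
  (forall i, i \in r -> P i -> pint p (f i)) -> pint p (\sum_(i <- r | P i) f i).
Proof.
move=> H; rewrite big_seq_cond; apply: big_ind; first exact: pint0.
  exact: pintD.
by move=> i /andP[? ?]; apply: H.
Qed.

Lemma pintVn n : coprime p n -> pint p n%:R^-1.
Proof.
move=> cn; exists n => //; have [->|n0] := eqVneq n 0%N.
  by rewrite mul0r Aint0.
by rewrite mulfV ?Aint1 // pnatr_eq0.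
Qed.

Lemma cong_refl x : cong p x x.
Proof. by rewrite /cong subrr mul0r; apply: pint0. Qed.

Lemma cong_sym x y : cong p x y -> cong p y x.
Proof. by move=> /pintN; rewrite /cong -mulNr opprB. Qed.

Lemma cong_trans y x z : cong p x y -> cong p y z -> cong p x z.
Proof.
by move=> /pintD H /H; rewrite /cong -mulrDl addrA subrK.
Qed.

Lemma congD x x' y y' :
  cong p x x' -> cong p y y' -> cong p (x + y) (x' + y').
Proof.
move=> /pintD H /H; rewrite /cong -mulrDl.
by have -> : x - x' + (y - y') = x + y - (x' + y') by ring.
Qed.

Lemma congN x y : cong p x y -> cong p (- x) (- y).
Proof. by move=> /pintN; rewrite /cong -mulNr opprD. Qed.

Lemma congB x x' y y' :
  cong p x x' -> cong p y y' -> cong p (x - y) (x' - y').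
Proof. by move=> H /congN; apply: congD. Qed.

(** From x y - x' y' = (x - x') y' + x (y - y'), whence the integrality of just [x] and [y']. *)
Lemma congM x x' y y' : pint p x -> pint p y' ->
  cong p x x' -> cong p y y' -> cong p (x * y) (x' * y').
Proof.
move=> px py' H1 H2; have := pintD (pintM H1 py') (pintM px H2).
by rewrite /cong; congr pint; rewrite /=; ring.
Qed.

Lemma congMl z x y : pint p z -> cong p x y -> cong p (z * x) (z * y).
Proof. by move=> pz /(pintM pz); rewrite /cong mulrA mulrBr. Qed.

Lemma congX n x y : pint p x -> pint p y -> cong p x y -> cong p (x ^+ n) (y ^+ n).
Proof.
move=> px py H; elim: n => [|n IH]; first by rewrite !expr0; apply: cong_refl.
by rewrite !exprS; apply: congM => //; apply: pintX.
Qed.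

Lemma cong_sum (I : eqType) (r : seq I) (P : pred I) (f g : I -> algC) :
  (forall i, i \in r -> P i -> cong p (f i) (g i)) ->
  cong p (\sum_(i <- r | P i) f i) (\sum_(i <- r | P i) g i).
Proof.
by move=> H; rewrite /cong -sumrB mulr_suml; apply: pint_sum.
Qed.

Hypothesis p_prime : prime p.

Let p0 := natr_prime_neq0 p_prime.

Lemma congP x y : cong p x y <-> exists2 e, pint p e & x = y + p%:R * e.
Proof.
split=> [H|[e pe ->]].
  by exists ((x - y) / p%:R) => //; field.
by rewrite /cong; have -> : (y + p%:R * e - y) / p%:R = e by field.
Qed.

Lemma cong_pM x : pint p x -> cong p (p%:R * x) 0.
Proof. by move=> px; apply/congP; exists x; rewrite ?add0r. Qed.

Lemma cong_pint x y : cong p x y -> pint p y -> pint p x.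
Proof.
case/congP=> e pe -> py; apply: pintD => //; apply: pintM => //.
exact: pint_nat.
Qed.

Lemma pintV_small k : (0 < k < p)%N -> pint p k%:R^-1.
Proof.
case/andP=> k0 kp; apply: pintVn; rewrite prime_coprime //.
by apply/negP=> /dvdn_leq; rewrite k0 leqNgt kp => /(_ isT).
Qed.

(** Some n (a - b) / p with n prime to p is a rational algebraic integer, hence an integer, and
    Gauss's lemma removes n. *)
Lemma cong_int (a b : int) : cong p a%:~R b%:~R -> (p%:Z %| a - b)%Z.
Proof.
case=> n cn; set z := _ * _ => zA.
have zQ : z \in Crat.
  by rewrite /z -rmorphB; apply: rpredM;
   rewrite ?rpred_nat // rpred_div ?rpred_nat ?rpred_int.
have /intrP[k Ek] := Cint_rat_Aint zQ zA.
have E : (n%:Z * (a - b))%:~R = (k * p%:Z)%:~R :> algC.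
  by rewrite !intrM -Ek /z rmorphB /=; field.
move/intr_inj: E => E.
have : (p%:Z %| n%:Z * (a - b))%Z by rewrite E; apply: dvdz_mull.
by rewrite Gauss_dvdzr // /coprimez /= gcdzE /= eqz_nat.
Qed.

Lemma frobenius x y : pint p x -> pint p y ->
  cong p ((x + y) ^+ p) (x ^+ p + y ^+ p).
Proof.
move=> px py; apply/congP.
(* The middle binomial terms, each coefficient divided by [p]. *)
exists (\sum_(1 <= i < p) (x ^+ (p - i) * y ^+ i) *+ ('C(p, i) %/ p)).
  apply: pint_sum => i _ _; rewrite -mulr_natr.
  by apply: pintM; [apply: pintM; apply: pintX | apply: pint_nat].
rewrite exprDn -(big_mkord xpredT (fun i => (x ^+ (p - i) * y ^+ i) *+ 'C(p, i))).
rewrite big_nat_recr //= big_ltn ?prime_gt0 //.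
rewrite subn0 expr0 mulr1 bin0 binn subnn expr0 mul1r !mulr1n.
rewrite -!addrA; congr (_ + _); rewrite addrC; congr (_ + _).
rewrite mulr_sumr; apply: eq_big_nat => i /andP[i1 ip].
by rewrite mulr_natl -mulrnA divnK // prime_dvd_bin // i1.
Qed.

Lemma fermat_nat n : cong p (n%:R ^+ p) n%:R.
Proof.
elim: n => [|n IH].
  by rewrite expr0n; case: eqP p_prime => [->|_ _] //; apply: cong_refl.
rewrite -addn1 natrD; apply: cong_trans (frobenius _ _) _.
- exact: pint_nat.
- exact: pint1.
by rewrite expr1n; apply: congD => //; apply: cong_refl.
Qed.

Lemma lqE x y : y != 0 -> x ^+ p = y * (1 + p%:R * lq p x y).
Proof. by move=> y0; rewrite /lq; field; rewrite p0 y0. Qed.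

Lemma lq_pint x y : y != 0 -> pint p y^-1 -> cong p (x ^+ p) y -> pint p (lq p x y).
Proof.
move=> y0 py H; have := pintM py H; rewrite /cong /lq.
by congr pint; field; rewrite p0 y0.
Qed.

(** (1 + p u)(1 + p v) = 1 + p (u + v + p u v): the error is [p] times the product of the two
    quotients. *)
Lemma lqM x x' y y' : y != 0 -> y' != 0 -> pint p (lq p x y) -> pint p (lq p x' y') ->
  cong p (lq p (x * x') (y * y')) (lq p x y + lq p x' y').
Proof.
move=> y0 y0' H H'; apply/congP; exists (lq p x y * lq p x' y').
  exact: pintM.
by rewrite /lq exprMn; field; rewrite p0 y0 y0'.
Qed.

End Localization.

(** * Central binomial sums *)

(** A rational algebraic integer is an integer, so the denominator of x divides n times its
    numerator, hence divides n, which is prime to p. *)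
Lemma pint_ratr p x : pint p (ratr x) -> pintegral p x.
Proof.
case=> n cn; rewrite -[n%:R](ratr_nat algC) -rmorphM /= => nA.
have /intrP[k] := Cint_rat_Aint (Crat_rat (n%:R * x)) nA.
rewrite -(ratr_int algC k) => /fmorph_inj E.
rewrite /pintegral; apply: coprime_dvdr cn.
have d0 : (denq x)%:~R != 0 :> rat by rewrite intr_eq0 denq_neq0.
have E2 : n%:Z * numq x = k * denq x.
  apply: (@intr_inj rat); rewrite !intrM -E -{2}[x]divq_num_den.
  by field.
have : (denq x %| n%:Z * numq x)%Z by rewrite E2 dvdz_mull.
rewrite Gauss_dvdzl; first by rewrite dvdzE.
by rewrite /coprimez /gcdz gcdnC; have := coprime_num_den x; rewrite /coprime => /eqP->.
Qed.

(** The way back to [rat]: integrality is needed on one side only, since the congruence transfers it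
    to the other. *)
Lemma cong_ratcong p x y :
  prime p -> pint p (ratr x) -> cong p (ratr x) (ratr y) -> ratcong p x y.
Proof.
move=> pp px H; have p0 : p%:R != 0 :> rat by rewrite pnatr_eq0 -lt0n prime_gt0.
split; [exact: pint_ratr | apply: pint_ratr |].
  by apply: cong_pint (cong_sym H) px.
exists ((x - y) / p%:R); last by field.
by apply: pint_ratr; rewrite fmorph_div rmorphB /= ratr_nat.
Qed.

(** The sum of a^i b^(N-i) over 0 <= i <= N, for a, b the roots of X^2 - m X + m, expanded in powers
    of m; the terms with 2k > N vanish. *)
Definition waringW (m : algC) (N : nat) : algC :=
  \sum_(k < N.+1) 'C(N - k, k)%:R * (-1) ^+ k * m ^+ (N - k).

(** Pascal's rule, term by term. *)
Lemma waringW_rec m N : waringW m N.+2 = m * (waringW m N.+1 - waringW m N).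
Proof.
rewrite /waringW mulrBr !mulr_sumr.
rewrite big_ord_recl [X in _ = X - _]big_ord_recl big_ord_recr /=.
rewrite !subn0 !bin0 bin_small; last by rewrite /bump /=; lia.
rewrite !mul0r addr0 -addrA -sumrB; congr (_ + _).
  by rewrite !mul1r -exprS.
apply: eq_bigr => i _; rewrite /bump /= !add1n !subSS.
rewrite subSn; last by have := ltn_ord i; lia.
by rewrite binS natrD !exprS; ring.
Qed.

(** Power sums and the right-hand side obey the same second-order recurrence, so two consecutive
    exponents suffice. *)
Lemma waringE (m a b : algC) N : a + b = m -> a * b = m ->
  a ^+ N.+2 + b ^+ N.+2 = waringW m N.+2 - m * waringW m N.
Proof.
move=> abD abM.
have W0 : waringW m 0 = 1 by rewrite /waringW big_ord1 !expr0 bin0 !mulr1.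
have W1 : waringW m 1 = m.
  by rewrite /waringW !big_ord_recr big_ord0 /= bin0 bin_small //; ring.
suff [] : a ^+ N.+2 + b ^+ N.+2 = waringW m N.+2 - m * waringW m N /\
  a ^+ N.+3 + b ^+ N.+3 = waringW m N.+3 - m * waringW m N.+1 by [].
elim: N => [|N [IH1 IH2]].
  split; rewrite !waringW_rec W0 W1.
    have -> : a ^+ 2 + b ^+ 2 = (a + b) ^+ 2 - 2 * (a * b) by ring.
    by rewrite abD abM; ring.
  have -> : a ^+ 3 + b ^+ 3 = (a + b) ^+ 3 - 3 * (a * b) * (a + b) by ring.
  by rewrite abD abM; ring.
split=> //.
have -> : a ^+ N.+4 + b ^+ N.+4 =
   m * ((a ^+ N.+3 + b ^+ N.+3) - (a ^+ N.+2 + b ^+ N.+2)).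
  rewrite mulrBr -{1}abD -abM !exprS; ring.
by rewrite IH1 IH2 (waringW_rec m N.+2) (waringW_rec m N); ring.
Qed.

Lemma cong_prod p n (f g : nat -> algC) :
  (forall i, pint p (f i)) -> (forall i, pint p (g i)) ->
  (forall i, cong p (f i) (g i)) ->
  cong p (\prod_(i < n) f i) (\prod_(i < n) g i).
Proof.
move=> pf pg fg.
suff [] : pint p (\prod_(i < n) f i) /\
  cong p (\prod_(i < n) f i) (\prod_(i < n) g i) by [].
elim: n => [|n [IH1 IH2]].
  by rewrite !big_ord0; split; [apply: pint1 | apply: cong_refl].
by rewrite !big_ord_recr /=; split; [apply: pintM | apply: congM].
Qed.

Lemma natr_ffact n l : (n ^_ l)%:R = \prod_(i < l) (n%:R - i%:R) :> algC.
Proof.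
elim: l => [|l IH]; first by rewrite big_ord0.
rewrite ffactnSr natrM big_ord_recr /= -IH.
(* Truncated and true subtraction disagree only for l > n, where the product accumulated so far is
   already 0. *)
case: (leqP l n) => [ln|nl]; first by rewrite natrB.
by rewrite ffact_small // !mul0r.
Qed.

Lemma pint_factV p l : prime p -> (l < p)%N -> pint p l`!%:R^-1.
Proof.
move=> pp lp; apply: pintVn; rewrite prime_coprime //.
elim: l lp => [|l IH] lp; first by rewrite fact0 dvdn1; case: eqP pp => // ->.
by rewrite factS Euclid_dvdM // negb_or IH ?gtnNdvd // ltnW.
Qed.

(** For k = j + 1, C(2k, k) = 2 C(2j+1, j). Multiplied by j!, C(p-j-2, j) and C(2j+1, j) become
    products over i < j of p - (j+2+i) and of j+2+i, which agree modulo p up to the sign (-1)^j. *)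
Lemma bin_cong p k : prime p -> (0 < k < p)%N ->
  cong p (2 * (-1) ^+ k.-1 * 'C((p - k).-1, k.-1)%:R) 'C(2 * k, k)%:R.
Proof.
move=> pp; case: k => [|j] // /andP[_ jp].
have -> : 'C(2 * j.+1, j.+1) = (2 * 'C((2 * j).+1, j))%N.
  have -> : (2 * j.+1 = (2 * j).+2)%N by lia.
  rewrite binS.
  have -> : 'C((2 * j).+1, j.+1) = 'C((2 * j).+1, j).
    by rewrite -bin_sub; [congr 'C(_, _) | ]; lia.
  by rewrite addnn -mul2n.
have f0 : j`!%:R != 0 :> algC by rewrite pnatr_eq0 -lt0n fact_gt0.
have pf : pint p j`!%:R^-1 by apply: pint_factV => //; lia.
have binE n : 'C(n, j)%:R = j`!%:R^-1 * \prod_(i < j) (n%:R - i%:R) :> algC.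
  by rewrite -natr_ffact -bin_ffact natrM; field.
rewrite -subnS natrM -mulrA; apply: congMl; first exact: pint_nat.
rewrite !binE mulrCA; apply: congMl => //.
(* Reversing the order turns the factors 2j+1-i into j+2+i, so that the two products match factor by
   factor. *)
rewrite [X in cong _ _ X](reindex_inj rev_ord_inj) /=.
rewrite -{1}[j]card_ord -prodr_const -big_split /=.
rewrite [X in cong _ X _](eq_bigr (fun i : 'I_j => (j.+2 + i)%:R - p%:R)); last first.
  by move=> i _; rewrite natrB ?natrD //; ring.
rewrite [X in cong _ _ X](eq_bigr (fun i : 'I_j => (j.+2 + i)%:R)); last first.
  by move=> i _; have ij := ltn_ord i; rewrite -natrB; [congr (_%:R) | ]; lia.
apply: (@cong_prod _ _ (fun i => (j.+2 + i)%:R - p%:R) (fun i => (j.+2 + i)%:R)).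
- by move=> i; apply: pintB; apply: pint_nat.
- by move=> i; apply: pint_nat.
move=> i; rewrite -[X in cong _ _ X]subr0; apply: congB; first exact: cong_refl.
by rewrite -[p%:R]mulr1; apply: cong_pM => //; apply: pint1.
Qed.

Lemma power_sum_prime p (m a b : algC) : prime p -> odd p -> a + b = m -> a * b = m ->
  m ^+ p - (a ^+ p + b ^+ p) = p%:R *
    \sum_(1 <= k < p) (-1) ^+ k.-1 * 'C((p - k).-1, k.-1)%:R / k%:R * m ^+ (p - k).
Proof.
move=> pp po abD abM.
have := prime_gt1 pp; move: pp po; case: p => [|[|n]] // pp po _.
rewrite (waringE _ abD abM) {1}/waringW.
(* The term k = 0 is m^p; the term k = p vanishes because C(0, p) = 0. *)
rewrite big_ord_recl big_ord_recr /= /bump leq0n add1n subnn (@bin_small 0) // !mul0r addr0.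
rewrite subn0 bin0 expr0 !mul1r opprB opprD addrCA addNKr.
rewrite big_add1 big_mkord /waringW !mulr_sumr -sumrB; apply: eq_bigr => i _.
have ij := ltn_ord i.
have -> : (n.+2 - (1 + i) = (n - i).+1)%N by lia.
rewrite add1n !exprS.
have i0 : i.+1%:R != 0 :> algC by rewrite pnatr_eq0.
(* With k = i + 1 this reads C(p-k, k) = (p-k)/k C(p-k-1, k-1); adding C(p-k-1, k-1), which comes
   from the second Waring sum, gives the coefficient p/k. *)
have -> : 'C((n - i).+1, i.+1)%:R = (n - i).+1%:R * 'C(n - i, i)%:R / i.+1%:R :> algC.
  by rewrite -natrM (mul_bin_diag (n - i).+1) natrM mulrC mulKf.
have -> : n.+2%:R = (n - i).+1%:R + i.+1%:R :> algC by rewrite -natrD; congr _%:R; lia.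
by move: (i.+1%:R : algC) i0 => c i0; field.
Qed.

Lemma central_binomial_sum p (m a b : algC) : prime p -> odd p ->
  m != 0 -> pint p m -> pint p m^-1 -> cong p (m ^+ p) m -> a + b = m -> a * b = m ->
  cong p (\sum_(1 <= k < p) 'C(2 * k, k)%:R / (k%:R * m ^+ k))
         (2 * (m ^+ p - (a ^+ p + b ^+ p)) / (p%:R * m)).
Proof.
move=> pp po m0 pm pmV mp abD abM; rewrite (power_sum_prime pp po abD abM).
have p0 := natr_prime_neq0 pp.
set s := \sum_(1 <= k < p) _ * m ^+ _.
have -> : 2 * (p%:R * s) / (p%:R * m) = m^-1 * (2 * s) by field; rewrite p0 m0.
have ps : forall k, k \in index_iota 1 p -> (0 < k < p)%N by move=> k; rewrite mem_index_iota.
pose t := \sum_(1 <= k < p) 'C(2 * k, k)%:R / k%:R * m ^+ (p - k).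
have st : cong p (2 * s) t.
  rewrite mulr_sumr; apply: cong_sum => k /ps kp _.
  rewrite !mulrA; apply: congM.
  - apply: pintM; last exact: pintV_small.
    by do 2![apply: pintM; last exact: pint_nat || exact/pintX/pintN/pint1]; exact: pint_nat.
  - exact: pintX.
  - rewrite mulrC [X in cong _ _ X]mulrC; apply: congMl; first exact: pintV_small.
    exact: bin_cong.
  exact: cong_refl.
have tE : t = m ^+ p * \sum_(1 <= k < p) 'C(2 * k, k)%:R / (k%:R * m ^+ k).
  rewrite mulr_sumr; apply: eq_big_nat => k /andP[k0 kp].
  rewrite expfB // ; have k0' : k%:R != 0 :> algC by rewrite pnatr_eq0 -lt0n.
  by field; rewrite k0' expf_neq0.
set u := (X in cong _ X _) in tE *.
have pu : pint p u.
  apply: pint_sum => k /ps kp _; rewrite invfM; apply: pintM; first exact: pint_nat.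
  by apply: pintM; [exact: pintV_small | rewrite -exprVn; apply: pintX].
(* Here t = m^p u, and m^p is congruent to m, which cancels the remaining division by m. *)
apply: cong_sym; apply: cong_trans (congMl pmV st) _.
rewrite tE -[u in X in cong _ _ X](mulKf m0); apply: congMl => //.
by apply: congM => //; [apply: pintX | apply: cong_refl].
Qed.

(* [y] plays the role of the image of [x] under a Frobenius automorphism, which
   is never constructed. *)
Definition flift (p : nat) (x y : algC) : Prop :=
  [/\ y != 0, pint p y, pint p y^-1 & cong p (x ^+ p) y].

(** * Quotients of units and their Frobenius images *)

Section FrobeniusLift.
Variable p : nat.
Hypothesis p_prime : prime p.
Hypothesis p_odd : odd p.

Let p0 := natr_prime_neq0 p_prime.

Lemma flift_neq0 x y : flift p x y -> y != 0. Proof. by case. Qed.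

Lemma flift_lq_pint x y : flift p x y -> pint p (lq p x y).
Proof. by case=> ? ? ? ?; apply: lq_pint. Qed.

Lemma flift_lqE x y : flift p x y -> x ^+ p = y * (1 + p%:R * lq p x y).
Proof. by case=> ? ? ? ?; apply: lqE. Qed.

Lemma fliftM x y x' y' : flift p x y -> flift p x' y' -> flift p (x * x') (y * y').
Proof.
case=> y0 py pyV xy [y0' py' pyV' xy']; split.
- exact: mulf_neq0.
- exact: pintM.
- by rewrite invfM; apply: pintM.
by rewrite exprMn; apply: congM => //; apply: cong_pint xy py.
Qed.

Lemma flift_lqM x y x' y' : flift p x y -> flift p x' y' ->
  cong p (lq p (x * x') (y * y')) (lq p x y + lq p x' y').
Proof.
by move=> H H'; apply: lqM; rewrite ?(flift_neq0 H) ?(flift_neq0 H') //;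
  apply: flift_lq_pint.
Qed.

Lemma fliftN x y : flift p x y -> flift p (- x) (- y).
Proof.
case=> y0 py pyV xy; split.
- by rewrite oppr_eq0.
- exact: pintN.
- by rewrite invrN; apply: pintN.
by rewrite exprNn -signr_odd p_odd expr1 mulN1r; apply: congN.
Qed.

Lemma lqN x y : lq p (- x) (- y) = lq p x y.
Proof.
by rewrite /lq exprNn -signr_odd p_odd expr1 mulN1r invrN mulrNN.
Qed.

Lemma lq1 : lq p 1 1 = 0.
Proof. by rewrite /lq expr1n divr1 subrr mul0r. Qed.

Lemma flift_nat n : coprime p n -> flift p n%:R n%:R.
Proof.
move=> cn; have n0 : n != 0%N.
  by apply: contraL cn => /eqP->; rewrite /coprime gcdn0; case: eqP p_prime => // ->.
split; [by rewrite pnatr_eq0 | exact: pint_nat | exact: pintVn | exact: fermat_nat].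
Qed.

(** The inverse of y is w/z. For quadratic units, w is the conjugate of y and z its norm, both up to
    sign. *)
Lemma flift_dvd x y z w : pint p y -> pint p w -> cong p (x ^+ p) y ->
  y * w = z -> z != 0 -> pint p z^-1 -> flift p x y.
Proof.
move=> py pw xy E z0 pz.
have y0 : y != 0 by apply: contraNneq z0 => y0; rewrite -E y0 mul0r.
have w0 : w != 0 by apply: contraNneq z0 => w0; rewrite -E w0 mulr0.
split=> //; have -> : y^-1 = w * z^-1 by rewrite -E; field; rewrite w0.
exact: pintM.
Qed.

(** Write M, A, B for the three quotients. Since m = a' + b', the terms free of p cancel in m^p -
    a^p - b^p and 2 (m M - a' A - b' B) / m is left; M is congruent to A + B because m = a b, which
    gives the antisymmetric form. *)
Lemma central_binomial_lq m a b a' b' :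
  flift p m m -> flift p a a' -> flift p b b' ->
  a + b = m -> a * b = m -> a' + b' = m -> a' * b' = m ->
  cong p (\sum_(1 <= k < p) 'C(2 * k, k)%:R / (k%:R * m ^+ k))
    (lq p m m - (a' - b') / m * (lq p a a' - lq p b b')).
Proof.
move=> fm fa fb abD abM abD' abM'.
case: (fm) => m0 pm pmV mm.
apply: cong_trans (central_binomial_sum p_prime p_odd m0 pm pmV mm abD abM) _.
have H := flift_lqM fa fb; rewrite abM abM' in H.
rewrite (flift_lqE fm) (flift_lqE fa) (flift_lqE fb).
case/(congP p_prime): H => e pe H.
have H2 : lq p b b' = lq p m m - lq p a a' - p%:R * e by rewrite H; ring.
rewrite H2; have Eb : b' = m - a' by rewrite -abD'; ring.
apply/(congP p_prime); exists e => //; rewrite Eb; field; by rewrite m0 p0.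
Qed.

End FrobeniusLift.

(** * Units of real quadratic fields *)

(* [e] is the Legendre symbol of [D] modulo [p], see [sqrt_lift_sign]. *)
Definition sqrt_lift (p D : nat) (s : algC) (e : int) : Prop :=
  [/\ s ^+ 2 = D%:R, pint p s, e = 1 \/ e = -1 & cong p (s ^+ p) (e%:~R * s)].

Section QuadraticFields.
Variable p : nat.
Hypothesis p_prime : prime p.
Hypothesis p_odd : odd p.

Let p0 := natr_prime_neq0 p_prime.

Lemma sqrt_liftN D s e : sqrt_lift p D s e -> sqrt_lift p D (- s) e.
Proof.
case=> sD ps he H; split=> //; first by rewrite sqrrN.
  exact: pintN.
by rewrite exprNn -signr_odd p_odd expr1 mulN1r mulrN; apply: congN.
Qed.

Lemma coprime_p2 : coprime p 2.
Proof. by rewrite coprimen2. Qed.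

Lemma frob_natD c s t : pint p s -> cong p (s ^+ p) t ->
  cong p ((c%:R + s) ^+ p) (c%:R + t).
Proof.
move=> ps st; apply: cong_trans (frobenius p_prime (pint_nat p c) ps) _.
by apply: congD => //; apply: fermat_nat.
Qed.

Lemma sqrt_flift D s e : coprime p D -> sqrt_lift p D s e -> flift p s (e%:~R * s).
Proof.
move=> cD [sD ps he H]; have [D0 _ DV _] := flift_nat p_prime cD.
apply: (@flift_dvd p _ _ D%:R (e%:~R * s)) => //.
- by apply: pintM => //; apply: pint_int.
- by apply: pintM => //; apply: pint_int.
by rewrite -sD; case: he => ->; ring.
Qed.

Lemma silver_flift s e : sqrt_lift p 2 s e -> flift p (1 + s) (1 + e%:~R * s).
Proof.
case=> sD ps he H; apply: (@flift_dvd p _ _ 1 (e%:~R * s - 1)); rewrite ?oner_eq0 ?invr1 //.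
- by apply: pintD; [exact: pint1 | apply: pintM => //; exact: pint_int].
- by apply: pintB; [apply: pintM => //; exact: pint_int | exact: pint1].
- exact: (frob_natD 1).
- by case: he => ->; ring: sD.
exact: pint1.
Qed.

Lemma eta_flift s e : sqrt_lift p 3 s e -> flift p (1 + s) (1 + e%:~R * s).
Proof.
case=> sD ps he H; have [f0 _ fV _] := flift_nat p_prime coprime_p2.
apply: (@flift_dvd p _ _ 2 (e%:~R * s - 1)) => //.
- by apply: pintD; [exact: pint1 | apply: pintM => //; exact: pint_int].
- by apply: pintB; [apply: pintM => //; exact: pint_int | exact: pint1].
- exact: (frob_natD 1).
by case: he => ->; ring: sD.
Qed.

Lemma omega_flift s e : sqrt_lift p 3 s e -> flift p (2 + s) (2 + e%:~R * s).
Proof.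
case=> sD ps he H; apply: (@flift_dvd p _ _ 1 (2 - e%:~R * s)); rewrite ?oner_eq0 ?invr1 //.
- by apply: pintD; [exact: (pint_nat p 2) | apply: pintM => //; exact: pint_int].
- by apply: pintB; [exact: (pint_nat p 2) | apply: pintM => //; exact: pint_int].
- exact: (frob_natD 2).
- by case: he => ->; ring: sD.
exact: pint1.
Qed.

Lemma golden_flift s e : sqrt_lift p 5 s e ->
  flift p ((1 + s) / 2) ((1 + e%:~R * s) / 2).
Proof.
case=> sD ps he H; have [t0 _ tV tt] := flift_nat p_prime coprime_p2.
(* Inverts the congruence 2^p = 2, as the denominator is outside the reach of the additivity of the
   p-th power. *)
have half : cong p (2^-1 ^+ p) (2^-1 : algC).
  have := pintM (pintM (pintX p tV) tV) (cong_sym tt).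
  rewrite /cong exprVn; congr pint; move: (_ ^+ p) (expf_neq0 p t0) => c c0.
  by field; rewrite p0 c0.
apply: (@flift_dvd p _ _ 1 ((e%:~R * s - 1) / 2)); rewrite ?oner_eq0 ?invr1 //.
- apply: pintM => //; apply: pintD; first exact: pint1.
  by apply: pintM => //; exact: pint_int.
- apply: pintM => //; apply: pintB; last exact: pint1.
  by apply: pintM => //; exact: pint_int.
- rewrite exprMn; apply: congM => //; last exact: (frob_natD 1).
  by apply: pintX; apply: pintD => //; exact: pint1.
- by case: he => ->; field: sD.
exact: pint1.
Qed.

(** An exact identity. If the p-th power map fixes x and y modulo p, then x^(p-1) = 1 + p lq; if it
    swaps them, then x^(p+1) = x y (1 + p lq), and likewise for y. *)
Lemma conj_pow_sub x y x' y' (e : int) : flift p x x' -> flift p y y' ->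
  x != 0 -> y != 0 ->
  (e = 1 /\ x' = x /\ y' = y) \/ (e = -1 /\ x' = y /\ y' = x) ->
  x ^+ `|p%:Z - e|%N - y ^+ `|p%:Z - e|%N =
    (if e == 1 then 1 else x * y) * p%:R * (lq p x x' - lq p y y').
Proof.
move=> fx fy x0 y0 H; have := flift_lqE p_prime fx; have := flift_lqE p_prime fy.
have p1 := prime_gt1 p_prime.
case: H => [[e1 [xx yy]]|[e1 [xx yy]]]; rewrite e1.
  have -> : `|p%:Z - 1|%N = p.-1 by lia.
  rewrite -(prednK (prime_gt0 p_prime)) !exprS (prednK (prime_gt0 p_prime)) {1}yy {1}xx.
  move/(mulfI y0) => ->; move/(mulfI x0) => ->; rewrite eqxx; ring.
rewrite opprK; have -> : `|(p%:Z + 1)%R|%N = p.+1 by lia.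
by rewrite !exprS => -> -> /=; rewrite xx yy; ring.
Qed.

Lemma fibE s N : s ^+ 2 = 5 ->
  s * (fib N)%:R = ((1 + s) / 2) ^+ N - ((1 - s) / 2) ^+ N :> algC.
Proof.
move=> sD; suff [] : s * (fib N)%:R = ((1 + s) / 2) ^+ N - ((1 - s) / 2) ^+ N :> algC /\
  s * (fib N.+1)%:R = ((1 + s) / 2) ^+ N.+1 - ((1 - s) / 2) ^+ N.+1 :> algC by [].
elim: N => [|N [IH1 IH2]]; first by rewrite /= !expr0 !expr1; split; field.
split=> //.
have -> : fib N.+2 = (fib N.+1 + fib N)%N by [].
rewrite natrD mulrDr IH1 IH2 !exprS.
by move: (_ ^+ N) (_ ^+ N) => A B; field: sD.
Qed.

Lemma pellE s N : s ^+ 2 = 2 ->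
  2 * s * (pell N)%:R = (1 + s) ^+ N - (1 - s) ^+ N :> algC.
Proof.
move=> sD; suff [] : 2 * s * (pell N)%:R = (1 + s) ^+ N - (1 - s) ^+ N :> algC /\
  2 * s * (pell N.+1)%:R = (1 + s) ^+ N.+1 - (1 - s) ^+ N.+1 :> algC by [].
elim: N => [|N [IH1 IH2]]; first by rewrite /= !expr0 !expr1; split; ring.
split=> //.
have -> : pell N.+2 = (2 * pell N.+1 + pell N)%N by [].
rewrite natrD natrM mulrDr IH1 mulrCA IH2 !exprS.
move: (_ ^+ N) (_ ^+ N) => A B; ring: sD.
Qed.

(** Binet's formula for the roots 2 + s and 2 - s, restated through (1 + s)^2 = 2 (2 + s): doubling
    the exponent is what puts the index of S at half of p - e. *)
Lemma seqSE s N : s ^+ 2 = 3 ->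
  2 ^+ N * (2 * s) * (seqS N)%:~R = (1 + s) ^+ (2 * N) - (1 - s) ^+ (2 * N) :> algC.
Proof.
move=> sD; rewrite !exprM.
have -> : (1 + s) ^+ 2 = 2 * (2 + s) by ring: sD.
have -> : (1 - s) ^+ 2 = 2 * (2 - s) by ring: sD.
rewrite !exprMn -mulrBr -!mulrA; congr (_ * _).
suff [] : 2 * (s * (seqS N)%:~R) = (2 + s) ^+ N - (2 - s) ^+ N :> algC /\
  2 * (s * (seqS N.+1)%:~R) = (2 + s) ^+ N.+1 - (2 - s) ^+ N.+1 :> algC by [].
elim: N => [|N [IH1 IH2]]; first by rewrite /= !expr0 !expr1; split; ring.
split=> //.
have -> : seqS N.+2 = 4 * seqS N.+1 - seqS N by [].
have -> : 2 * (s * (4 * seqS N.+1 - seqS N)%:~R) =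
  4 * (2 * (s * (seqS N.+1)%:~R)) - 2 * (s * (seqS N)%:~R) :> algC.
  by rewrite rmorphB rmorphM /=; ring.
rewrite IH1 IH2 !exprS.
move: (_ ^+ N) (_ ^+ N) => A B; ring: sD.
Qed.

End QuadraticFields.

(** * Harmonic sums and roots of unity *)

Lemma prim_root_half n (z : algC) : (0 < n)%N -> (2 * n).-primitive_root z -> z ^+ n = -1.
Proof.
move=> n0 zP; have : (z ^+ n) ^+ 2 == 1 by rewrite -exprM mulnC (prim_expr_order zP).
rewrite -subr_eq0 subr_sqr_1 mulf_eq0 subr_eq0 addr_eq0 => /orP[] /eqP // E.
by have := prim_order_dvd zP n; rewrite E eqxx => /dvdn_leq; lia.
Qed.

(** The z^(2r+1) are the roots of x^d = -1. Their j-th powers form a geometric progression of ratio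
    z^(2j), which is 1 exactly when d divides j. *)
Lemma odd_root_sum d (z : algC) j : (0 < d)%N -> (2 * d).-primitive_root z ->
  \sum_(r < d) (z ^+ (2 * r).+1) ^+ j = if (d %| j)%N then d%:R * (-1) ^+ (j %/ d) else 0.
Proof.
move=> d0 zP.
have -> : \sum_(r < d) (z ^+ (2 * r).+1) ^+ j = z ^+ j * \sum_(r < d) (z ^+ (2 * j)) ^+ r.
  rewrite mulr_sumr; apply: eq_bigr => r _; rewrite -!exprM -exprD; congr (_ ^+ _); lia.
have zd := prim_root_half d0 zP.
case: ifP => [/dvdnP[k ->]|dj].
  rewrite mulnK // mulnC exprM zd mulrC; congr (_ * _).
  rewrite (eq_bigr (fun=> 1)) ?sumr_const ?card_ord // => r _.
  have -> : (2 * (d * k) = 2 * d * k)%N by lia.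
  by rewrite exprM (prim_expr_order zP) !expr1n.
have w1 : z ^+ (2 * j) != 1.
  by rewrite -(prim_order_dvd zP) dvdn_pmul2l // dj.
suff -> : \sum_(r < d) (z ^+ (2 * j)) ^+ r = 0 by rewrite mulr0.
apply: (mulfI (_ : z ^+ (2 * j) - 1 != 0)); first by rewrite subr_eq0.
rewrite -subrX1 mulr0 -exprM.
have -> : (2 * j * d = 2 * d * j)%N by lia.
by rewrite exprM (prim_expr_order zP) expr1n subrr.
Qed.

Section HarmonicSums.
Variable p : nat.
Hypothesis p_prime : prime p.
Hypothesis p_odd : odd p.

Let p0 := natr_prime_neq0 p_prime.

(** By Pascal's rule, C(p-1, j+1) + C(p-1, j) = C(p, j+1) is divisible by p. *)
Lemma bin_pred_cong j : (j < p)%N -> cong p 'C(p.-1, j)%:R ((-1) ^+ j).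
Proof.
elim: j => [|j IH] jp; first by rewrite bin0 expr0; apply: cong_refl.
have E : ('C(p, j.+1) = 'C(p.-1, j.+1) + 'C(p.-1, j))%N.
  by rewrite -{1}(prednK (prime_gt0 p_prime)) binS.
have -> : 'C(p.-1, j.+1)%:R = 'C(p, j.+1)%:R - 'C(p.-1, j)%:R :> algC.
  by rewrite E natrD addrK.
rewrite exprS mulN1r -[X in cong _ _ X]add0r; apply: congB; last by apply: IH; apply: ltnW.
have /dvdnP[k ->] : (p %| 'C(p, j.+1))%N by apply: prime_dvd_bin.
by rewrite natrM mulrC; apply: cong_pM => //; apply: pint_nat.
Qed.

Lemma bin_quot_cong k : (0 < k < p)%N ->
  cong p ('C(p, k)%:R / p%:R) ((-1) ^+ k.-1 / k%:R).
Proof.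
case: k => // k /andP[_ kp].
have k0 : k.+1%:R != 0 :> algC by rewrite pnatr_eq0.
have -> : 'C(p, k.+1)%:R / p%:R = 'C(p.-1, k)%:R / k.+1%:R :> algC.
  apply/eqP; rewrite eqr_div // -!natrM; apply/eqP; congr _%:R.
  by rewrite mulnC -mul_bin_diag mulnC.
rewrite mulrC [X in cong _ _ X]mulrC; apply: congMl; first exact: pintV_small.
by apply: bin_pred_cong; apply: ltnW.
Qed.

Lemma sum_expr2_quot :
  cong p (2 * lq p 2 2) (\sum_(1 <= k < p) (-1) ^+ k.-1 / k%:R).
Proof.
have -> : 2 * lq p 2 2 = \sum_(1 <= k < p) 'C(p, k)%:R / p%:R.
  rewrite -mulr_suml.
  have -> : \sum_(1 <= k < p) 'C(p, k)%:R = 2 ^+ p - 2 :> algC.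
    rewrite -[2 ^+ p]natrX -[(2 ^ p)%N]/((1 + 1) ^ p)%N expnDn.
    rewrite -(big_mkord xpredT (fun i => 'C(p, i) * (1 ^ (p - i) * 1 ^ i)))%N.
    rewrite big_nat_recr //= [in RHS]big_ltn ?prime_gt0 // bin0 binn subnn subn0 !exp1n !muln1.
    rewrite !natrD natr_sum (eq_bigr (fun k => 'C(p, k)%:R)).
      ring.
    by move=> i _; rewrite !exp1n !muln1.
  by rewrite /lq; field.
by apply: cong_sum => k; rewrite mem_index_iota => kp _; apply: bin_quot_cong.
Qed.

(** A double sum over the pairs with d k = j, taken in both orders. *)
Lemma sum_multiples d (f : nat -> algC) : (0 < d)%N ->
  \sum_(1 <= j < p | (d %| j)%N) f j = \sum_(1 <= k < p | (d * k < p)%N) f (d * k)%N.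
Proof.
move=> d0.
transitivity (\sum_(1 <= j < p) \sum_(1 <= k < p | (d * k == j)%N) f j).
  rewrite big_mkcond /=; apply: eq_big_nat => j /andP[j0 jp].
  case: ifP => [/dvdnP[k Ek]|dj]; last first.
    by rewrite big1 // => k /eqP E; rewrite -E dvdn_mulr in dj.
  rewrite (big_rem k) /=; last by rewrite mem_index_iota; nia.
  rewrite mulnC Ek eqxx big1_seq ?addr0 // => i /andP[/eqP E].
  have -> : i = k by nia.
  by rewrite mem_rem_uniq ?iota_uniq // inE eqxx.
rewrite (exchange_big_dep_nat xpredT) //= [RHS]big_mkcond /=.
apply: eq_big_nat => k /andP[k0 kp].
case: ifP => kd; last first.
  by rewrite big1_seq // => i /andP[/eqP E]; rewrite mem_index_iota; lia.
rewrite (big_rem (d * k)%N) /=; last by rewrite mem_index_iota; nia.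
rewrite eqxx big1_seq ?addr0 // => i /andP[/eqP <-].
by rewrite mem_rem_uniq ?iota_uniq // inE eqxx.
Qed.

(** Summing the binomial expansion over x^d = -1 keeps only the exponents j = d k, with weight d
    (-1)^k; dividing by p turns C(p, d k) into (-1)^(dk-1)/(d k) modulo p. *)
Lemma sum_root_quot d (z : algC) : (0 < d)%N -> ~~ odd d -> ~~ (d %| p)%N ->
  (2 * d).-primitive_root z ->
  cong p ((\sum_(r < d) (1 + z ^+ (2 * r).+1) ^+ p - d%:R) / p%:R)
    (\sum_(1 <= k < p | (d * k < p)%N) (-1) ^+ k.-1 / k%:R).
Proof.
move=> d0 de dp zP.
have -> : \sum_(r < d) (1 + z ^+ (2 * r).+1) ^+ p =
  d%:R + d%:R * \sum_(1 <= j < p | (d %| j)%N) (-1) ^+ (j %/ d) * 'C(p, j)%:R.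
  under eq_bigr do rewrite exprDn.
  rewrite exchange_big /=.
  pose f (j : nat) : algC :=
    (if (d %| j)%N then d%:R * (-1) ^+ (j %/ d) else 0) * 'C(p, j)%:R.
  rewrite (eq_bigr (fun j : 'I_p.+1 => f j)); last first.
    move=> j _; rewrite /f -(odd_root_sum _ d0 zP) mulr_suml; apply: eq_bigr => r _.
    by rewrite expr1n mul1r mulr_natr.
  rewrite -(big_mkord xpredT f) {}/f.
  (* The exponent p drops out since d does not divide p, and the exponent 0 supplies the term d. *)
  rewrite big_nat_recr //= (negbTE dp) mul0r addr0 big_ltn ?prime_gt0 //.
  rewrite dvdn0 div0n bin0 expr0 !mulr1.
  congr (_ + _); rewrite mulr_sumr [RHS]big_mkcond /=.
  by apply: eq_bigr => j _; case: ifP; rewrite ?mul0r // mulrA.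
rewrite addrAC subrr add0r -mulrA mulr_suml sum_multiples //.
rewrite mulr_sumr; apply: cong_sum => k; rewrite mem_index_iota => /andP[k0 kp] dk.
rewrite mulKn // -mulrA mulrCA.
have k0' : k%:R != 0 :> algC by rewrite pnatr_eq0 -lt0n.
have d0' : d%:R != 0 :> algC by rewrite pnatr_eq0 -lt0n.
have -> : (-1) ^+ k.-1 / k%:R = (-1) ^+ k * (d%:R * ((-1) ^+ (d * k).-1 / (d * k)%:R)) :> algC.
  (* As d is even, d k - 1 is odd. *)
  have -> : (-1) ^+ (d * k).-1 = -1 :> algC.
    rewrite -signr_odd -subn1 oddB ?muln_gt0 ?d0 // oddM (negbTE de) //.
  by rewrite -[in RHS](prednK k0) exprS (prednK k0) natrM; field; rewrite k0'.
apply: congMl; first exact/pintX/pintN/pint1.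
apply: congMl; first exact: pint_nat.
by apply: bin_quot_cong; rewrite muln_gt0 d0 k0.
Qed.

(** The substitution k -> p - k keeps (-1)^(k-1)/k modulo p, since p odd flips the sign and 1/(p-k)
    is congruent to -1/k; it carries k > (d-1)p/d to k < p/d. *)
Lemma sum_reflect d : ~~ (d %| p)%N -> (0 < d)%N ->
  cong p (\sum_(1 <= k < p | (d * k < d.-1 * p)%N) (-1) ^+ k.-1 / k%:R)
   (\sum_(1 <= k < p) (-1) ^+ k.-1 / k%:R -
    \sum_(1 <= k < p | (d * k < p)%N) (-1) ^+ k.-1 / k%:R).
Proof.
move=> dp d0.
pose g (k : nat) : algC := (-1) ^+ k.-1 / k%:R.
rewrite [X in cong _ _ (X - _)](bigID (fun k => d * k < d.-1 * p)%N) /=.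
rewrite -[X in cong _ X _]addr0 -addrA.
apply: congD; first exact: cong_refl.
apply: cong_sym; rewrite -[X in cong _ _ X](subrr (\sum_(1 <= k < p | (d * k < p)%N) g k)).
apply: congB; last exact: cong_refl.
rewrite big_nat_rev /= big_mkcond [X in cong _ _ X]big_mkcond /=.
apply: cong_sum => k; rewrite mem_index_iota => /andP[k0 kp] _.
rewrite add1n subSS.
have -> : (~~ (d * (p - k) < d.-1 * p))%N = (d * k < p)%N.
  (* The boundary case d k = p would make d divide p. *)
  have : (d * k)%N != p by apply: contraNneq dp => <-; apply: dvdn_mulr.
  by nia.
case: ifP => _; last exact: cong_refl.
have k0' : k%:R != 0 :> algC by rewrite pnatr_eq0 -lt0n.
have pk : (p - k)%:R != 0 :> algC by rewrite pnatr_eq0 -lt0n subn_gt0.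
apply/(congP p_prime); exists (- ((-1) ^+ k.-1 / k%:R * (p - k)%:R^-1)).
  apply/pintN/pintM; [apply: pintM | apply: pintV_small => //; lia].
    exact/pintX/pintN/pint1.
  by apply: pintV_small => //; lia.
have -> : (-1) ^+ (p - k).-1 = - (-1) ^+ k.-1 :> algC.
  rewrite -signr_odd -[in RHS]signr_odd.
  have -> : odd (p - k).-1 = ~~ odd k.-1 by lia.
  by case: (odd k.-1); rewrite /= ?opprK.
rewrite /g; move: pk; rewrite natrB 1?ltnW // => pk.
by field; rewrite k0' pk.
Qed.

End HarmonicSums.

(** * Legendre symbols *)

(** For a generator g of the unit group and a = g^k, the order p - 1 divides k (p-1)/2, so k is
    even. *)
Lemma Fp_square_root p (a : 'F_p) : prime p -> odd p -> a != 0 -> a ^+ (p.-1)./2 = 1 ->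
  exists b : 'F_p, b ^+ 2 = a.
Proof.
move=> pp po a0 a1.
have aU : a \is a GRing.unit by rewrite unitfE.
have /cyclicP[g gE] := field_unit_group_cyclic [set: {unit 'F_p}]%G.
have : FinRing.unit 'F_p aU \in <[g]>%g by rewrite -gE inE.
case/cycleP=> k Ek.
have og : #[g]%g = p.-1 by rewrite orderE -gE card_finField_unit card_Fp.
have E1 : (g ^+ (k * p.-1./2) = 1)%g.
  by apply: val_inj; rewrite expgM -Ek /= FinRing.val_unitX.
have : (#[g]%g %| k * p.-1./2)%N by rewrite order_dvdn E1.
rewrite og; have p1 := prime_gt1 pp.
have E2 : (p.-1 = 2 * p.-1./2)%N by lia.
rewrite {1}E2 dvdn_pmul2r; last by lia.
case/dvdnP=> l El; exists (val (g ^+ l)%g).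
by rewrite -FinRing.val_unitX -expgM -El -Ek.
Qed.

Lemma cong_nat p (m n : nat) : prime p -> m = n %[mod p] -> cong p m%:R n%:R.
Proof.
move=> pp E; rewrite (divn_eq m p) (divn_eq n p) E !natrD !natrM.
apply: congD; last exact: cong_refl.
apply: (cong_trans (y := 0)); last apply: cong_sym;
  by rewrite mulrC; apply: cong_pM => //; apply: pint_nat.
Qed.

(** Euler's criterion. If a is x^2 modulo p, the power is x^(p-1); otherwise it is a square root of
    1 in F_p, and the value 1 would make a a square. *)
Lemma legendreP p (a : nat) : prime p -> odd p -> ~~ (p %| a)%N ->
  (legendre a p = 1 \/ legendre a p = -1) /\
  cong p (a%:R ^+ (p.-1)./2) (legendre a p)%:~R.
Proof.
move=> pp po pa.
have p1 := prime_gt1 pp.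
have pE : (p.-1 = 2 * p.-1./2)%N by lia.
rewrite /legendre dvdzE /= (negbTE pa); case: existsP => [[x /eqP xa]|H]; split; auto.
  have xaN : (x ^ 2 = a %[mod p])%N.
    by move: xa; rewrite -[_ ^+ 2]/(x%:Z * x%:Z) -PoszM !modz_nat mulnn => -[].
  have px : coprime p x.
    rewrite prime_coprime //; apply: contra pa => px.
    by rewrite /dvdn -xaN -/(dvdn p (x ^ 2)) dvdn_exp.
  apply: (cong_trans (y := (x ^ 2)%:R ^+ (p.-1)./2)).
    apply: congX; [exact: pint_nat | exact: pint_nat | ].
    exact/cong_nat/esym.
  rewrite natrX -exprM -pE.
  have [x0 _ xV xx] := flift_nat pp px.
  have E : x%:R ^+ p = x%:R * x%:R ^+ p.-1 :> algC by rewrite -exprS (prednK (ltnW p1)).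
  by have := congMl xV xx; rewrite E mulKf // mulVf.
have aF0 : a%:R != 0 :> 'F_p by rewrite -(dvdn_pcharf (pchar_Fp pp)).
have : (a%:R ^+ (p.-1)./2 : 'F_p) ^+ 2 == 1.
  rewrite -exprM mulnC -pE; apply/eqP/(mulfI aF0).
  rewrite -exprS (prednK (ltnW p1)) mulr1.
  by have := expf_card (a%:R : 'F_p); rewrite card_Fp.
rewrite -subr_eq0 subr_sqr_1 mulf_eq0 subr_eq0 => /orP[/eqP|].
  case/(Fp_square_root pp po aF0) => b Eb; case: H.
  have bp : (b < p)%N by rewrite -[X in (_ < X)%N](Fp_cast pp).
  exists (Ordinal bp); rewrite /=.
  rewrite -[_ ^+ 2]/(b%:Z * b%:Z) -PoszM !modz_nat.
  have := val_Fp_nat pp (b ^ 2); rewrite natrX.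
  have -> : (b : nat)%:R = b by apply: natr_Zp.
  by rewrite Eb val_Fp_nat // mulnn => ->.
rewrite -natrX -[1]/(1%:R) -natrD -(dvdn_pcharf (pchar_Fp pp)) => /dvdnP[k Ek].
rewrite -[_%:R ^+ _](addrK 1) -natrX -[1 in X in cong _ X _]/(1%:R) -natrD Ek natrM.
rewrite -[X in cong _ _ X]add0r; apply: congD; last exact: cong_refl.
by rewrite mulrC; apply: cong_pM => //; apply: pint_nat.
Qed.

Lemma jacobi_prime a p : prime p -> jacobi a p = legendre a p.
Proof.
move=> pp; rewrite /jacobi prime_decompE primes_prime //= big_seq1 /=.
by rewrite logn_prime // eqxx expr1.
Qed.

Lemma jacobi5 (n : nat) : jacobi n 5 =
  if (n %% 5 == 0)%N then 0 else if (n %% 5 == 1)%N || (n %% 5 == 4)%N then 1 else -1.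
Proof.
rewrite jacobi_prime // /legendre dvdzE /= /dvdn.
case: ifP => // n0.
case: existsP => [[x]|H].
  rewrite -[_ ^+ 2]/(x%:Z * x%:Z) -PoszM !modz_nat eqz_nat => /eqP E.
  have : (n %% 5 < 5)%N by rewrite ltn_pmod.
  by move: n0; rewrite -E; case: x {E} => -[|[|[|[|[|]]]]].
have [n1|n1] := eqVneq (n %% 5)%N 1%N.
  by case: H; exists 1; rewrite -[_ ^+ 2]/(1%:Z * 1%:Z) -PoszM !modz_nat n1.
have [n4|n4] := eqVneq (n %% 5)%N 4%N.
  by case: H; exists 2; rewrite -[_ ^+ 2]/(2%:Z * 2%:Z) -PoszM !modz_nat n4.
by [].
Qed.

(** * Square roots from roots of unity *)

Lemma prim_root_neq0 n (z : algC) : n.-primitive_root z -> z != 0.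
Proof.
move=> zP; have n0 := prim_order_gt0 zP.
apply/eqP => z0; have /eqP := prim_expr_order zP.
by rewrite z0 expr0n gtn_eqF // eq_sym oner_eq0.
Qed.

Lemma root8_sqrt2 (z : algC) : 8.-primitive_root z -> (z + z^-1) ^+ 2 = 2.
Proof.
move=> zP; have z0 := prim_root_neq0 zP.
(* Thus z^2 + z^-2 = 0, and only the cross term 2 of the square survives. *)
have z4 : z ^+ 4 = -1 by apply: (prim_root_half _ (zP : (2 * 4).-primitive_root z)).
have -> : (z + z^-1) ^+ 2 = (z ^+ 4 + 1) / z ^+ 2 + 2 by field.
by rewrite z4 addNr mul0r add0r.
Qed.

Lemma root12_sqrt3 (z : algC) : 12.-primitive_root z -> (z + z^-1) ^+ 2 = 3.
Proof.
move=> zP; have z0 := prim_root_neq0 zP.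
have z6 : z ^+ 6 = -1 by apply: (prim_root_half _ (zP : (2 * 6).-primitive_root z)).
(* z^6 + 1 = (z^2 + 1)(z^4 - z^2 + 1), so the second factor must vanish, which means z^2 + z^-2 =
   1. *)
have z2 : z ^+ 2 + 1 != 0.
  apply/negP; rewrite addr_eq0 => /eqP E.
  by have := prim_order_dvd zP 4; rewrite (exprM z 2 2) E sqrrN expr1n eqxx.
have -> : (z + z^-1) ^+ 2 = (z ^+ 6 + 1) / (z ^+ 2 * (z ^+ 2 + 1)) + 3.
  by field; rewrite z0 z2.
by rewrite z6 addNr mul0r add0r.
Qed.

(* A quadratic Gauss sum: its p-th power gives the reciprocity (5/p) = (p/5). *)
Lemma root5_sqrt5 (z : algC) : 5.-primitive_root z -> (z - z ^+ 2 - z ^+ 3 + z ^+ 4) ^+ 2 = 5.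
Proof.
move=> zP; have z5 := prim_expr_order zP.
have z1 : z - 1 != 0.
  by rewrite subr_eq0; have := prim_order_dvd zP 1; rewrite expr1 => <-.
have E : 1 + z + z ^+ 2 + z ^+ 3 + z ^+ 4 = 0.
  apply: (mulfI z1); rewrite mulr0.
  by transitivity (z ^+ 5 - 1); [ring | rewrite z5 subrr].
have -> : (z - z ^+ 2 - z ^+ 3 + z ^+ 4) ^+ 2 =
  5 - (1 + z + z ^+ 2 + z ^+ 3 + z ^+ 4) + (z ^+ 5 - 1) * (z ^+ 3 - 2 * z ^+ 2 - z + 4) by ring.
by rewrite E z5; ring.
Qed.

Lemma sqrf_eq_sign (x y : algC) : x ^+ 2 = y ^+ 2 ->
  exists2 e : int, e = 1 \/ e = -1 & x = e%:~R * y.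
Proof.
move/eqP; rewrite eqf_sqr => /orP[] /eqP ->.
  by exists 1; rewrite ?mul1r; auto.
by exists (-1); rewrite ?mulN1r; auto.
Qed.

Section RootsOfUnity.
Variable p : nat.
Hypothesis p_prime : prime p.
Hypothesis p_odd : odd p.

Let p0 := natr_prime_neq0 p_prime.

Lemma pint_prim_root n z k : n.-primitive_root z -> pint p (z ^+ k).
Proof. by move=> zP; apply/pintX/pint_Aint/(Aint_prim_root zP). Qed.

Lemma pint_prim_rootV n z : n.-primitive_root z -> pint p z^-1.
Proof.
move=> zP; have n0 := prim_order_gt0 zP; have z0 := prim_root_neq0 zP.
have -> : z^-1 = z ^+ n.-1.
  by apply: (mulfI z0); rewrite mulfV // -exprS prednK // (prim_expr_order zP).
exact: pint_prim_root zP.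
Qed.

(** z^p + z^-p is again a square root of D, so it is plus or minus z + 1/z; it is also congruent to
    the p-th power of z + 1/z. *)
Lemma trace_sqrt_lift n D z : n.-primitive_root z ->
  (z + z^-1) ^+ 2 = D%:R -> (z ^+ p + z ^- p) ^+ 2 = D%:R ->
  exists2 e, sqrt_lift p D (z + z^-1) e & z ^+ p + z ^- p = e%:~R * (z + z^-1).
Proof.
move=> zP sD sD'; have pz := pint_prim_root 1 zP; rewrite expr1 in pz.
have pzV := pint_prim_rootV zP.
have [|e he E] := @sqrf_eq_sign (z ^+ p + z ^- p) (z + z^-1); first by rewrite sD.
exists e => //; split=> //; first exact: pintD.
by rewrite -E -exprVn; apply: frobenius.
Qed.

Lemma root8_lift z : 8.-primitive_root z ->
  exists2 e, sqrt_lift p 2 (z + z^-1) e & z ^+ p + z ^- p = e%:~R * (z + z^-1).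
Proof.
move=> zP; apply: (trace_sqrt_lift zP (root8_sqrt2 zP)).
apply: root8_sqrt2; rewrite (prim_root_exp_coprime _ zP).
by apply: (@coprimeXr 3 p 2); rewrite coprimen2.
Qed.

Lemma root12_lift z : (3 < p)%N -> 12.-primitive_root z ->
  exists2 e, sqrt_lift p 3 (z + z^-1) e & z ^+ p + z ^- p = e%:~R * (z + z^-1).
Proof.
move=> p3 zP; apply: (trace_sqrt_lift zP (root12_sqrt3 zP)).
apply: root12_sqrt3; rewrite (prim_root_exp_coprime _ zP).
have -> : coprime p 12 = coprime p (2 ^ 2) && coprime p 3 by rewrite -coprimeMr.
rewrite coprimeXr ?coprimen2 //=.
by rewrite prime_coprime // gtnNdvd.
Qed.

Lemma root5_lift z : p <> 5%N -> 5.-primitive_root z ->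
  sqrt_lift p 5 (z - z ^+ 2 - z ^+ 3 + z ^+ 4) (jacobi p 5).
Proof.
move=> p5 zP; have z5 := prim_expr_order zP.
have pz k := pint_prim_root k zP.
have n0 : (p %% 5 == 0)%N = false.
  apply/negbTE/negP => E; apply: p5; have : (5 %| p)%N by [].
  by rewrite dvdn_prime2 // => /eqP <-.
split; first exact: root5_sqrt5.
- by apply: pintD => //; do 2![apply: pintB => //]; rewrite -[z]expr1.
- by rewrite jacobi5 n0; case: ifP; auto.
have frobB x y : pint p x -> pint p y -> cong p ((x - y) ^+ p) (x ^+ p - y ^+ p).
  move=> px py; have := frobenius p_prime px (pintN py).
  by rewrite [(- y) ^+ p]exprNn -signr_odd p_odd expr1 mulN1r.
have pz1 : pint p z by have := pz 1%N; rewrite expr1.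
have H : cong p ((z - z ^+ 2 - z ^+ 3 + z ^+ 4) ^+ p)
   (z ^+ p - (z ^+ p) ^+ 2 - (z ^+ p) ^+ 3 + (z ^+ p) ^+ 4).
  apply: cong_trans (frobenius p_prime _ (pz _)) _.
    by do 2![apply: pintB => //].
  rewrite (exprAC z 4); apply: congD; last exact: cong_refl.
  apply: cong_trans (frobB _ _ _ (pz _)) _; first exact: pintB.
  rewrite (exprAC z 3); apply: congB; last exact: cong_refl.
  by rewrite (exprAC z p 2); apply: frobB.
suff <- : z ^+ p - (z ^+ p) ^+ 2 - (z ^+ p) ^+ 3 + (z ^+ p) ^+ 4 =
  (jacobi p 5)%:~R * (z - z ^+ 2 - z ^+ 3 + z ^+ 4) by [].
(* Only p modulo 5 matters: multiplying the exponents 1, 2, 3, 4 by p permutes them, and the signs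
   of the Gauss sum follow the squares modulo 5. *)
have -> : z ^+ p = z ^+ (p %% 5) by rewrite (prim_expr_mod zP).
rewrite jacobi5 n0; have : (p %% 5 < 5)%N by rewrite ltn_pmod.
have z6 : z ^+ 6 = z by rewrite exprSr z5 mul1r.
case: (p %% 5)%N n0 => [|[|[|[|[|]]]]] //= _ _; rewrite ?mulN1r ?mul1r.
- by rewrite expr1.
- by rewrite -!exprM /= [z ^+ (2 * 4)](exprD z 5 3) [z ^+ (2 * 3)](exprD z 5 1) z5; ring.
- by rewrite -!exprM /= [z ^+ (3 * 4)](exprD z 5 7) (exprD z 5 2) [z ^+ (3 * 3)](exprD z 5 4)
    [z ^+ (3 * 2)](exprD z 5 1) z5; ring.
by rewrite -!exprM /= [z ^+ (4 * 4)](exprD z 5 11) (exprD z 5 6) z6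
    [z ^+ (4 * 3)](exprD z 5 7) (exprD z 5 2) [z ^+ (4 * 2)](exprD z 5 3) z5; ring.
Qed.

(** 1 + x = x (1 + 1/x), and x goes with its exact p-th power, so 1 + x and 1 + 1/x share one
    quotient: half that of their product 2 + t modulo p. The images 1 + x^p and 1 + x^-p add up to 2
    + t'. *)
Lemma pair_root_quot (x : algC) : x != 0 -> pint p x -> pint p x^-1 ->
  let t := x + x^-1 in let t' := x ^+ p + x ^- p in
  flift p (2 + t) (2 + t') ->
  cong p (((1 + x) ^+ p + (1 + x^-1) ^+ p - (2 + t')) / p%:R)
    ((2 + t') / 2 * lq p (2 + t) (2 + t')).
Proof.
move=> x0 px pxV t t' [u0 pu uV utt].
have xp0 : x ^+ p != 0 by rewrite expf_neq0.
have E' : (1 + x ^+ p) * (1 + x ^- p) = 2 + t' by rewrite /t'; field.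
have E : (1 + x) * (1 + x^-1) = 2 + t by rewrite /t; field.
have pxp : pint p (x ^+ p) by apply: pintX.
have pxpV : pint p (x ^- p) by rewrite -exprVn; apply: pintX.
have fa : flift p (1 + x) (1 + x ^+ p).
  apply: (flift_dvd _ _ _ E') => //; try by apply: pintD => //; exact: pint1.
  exact: (frob_natD p_prime 1 px (cong_refl _ _)).
have fb : flift p (1 + x^-1) (1 + x ^- p).
  rewrite mulrC in E'; apply: (flift_dvd _ _ _ E') => //; try by apply: pintD => //; exact: pint1.
  by rewrite -exprVn; exact: (frob_natD p_prime 1 pxV (cong_refl _ _)).
have lE : lq p (1 + x) (1 + x ^+ p) = lq p (1 + x^-1) (1 + x ^- p).
  have a0 := flift_neq0 fa; have b0 := flift_neq0 fb.
  have -> : 1 + x = x * (1 + x^-1) by field.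
  have Ex : 1 + x ^+ p = x ^+ p * (1 + x ^- p) by field.
  rewrite Ex /lq exprMn -mulf_div divff // mul1r //.
have := flift_lqM p_prime fa fb; rewrite E E' -lE => H.
rewrite (flift_lqE p_prime fa) (flift_lqE p_prime fb) -lE.
case/(congP p_prime): H => e pe ->; apply/(congP p_prime).
exists (- ((2 + t') / 2 * e)); last by rewrite /t'; field; rewrite p0 xp0.
apply/pintN/pintM => //; apply: pintM => //.
by have [_ _ ? _] := flift_nat p_prime (coprime_p2 p_odd).
Qed.

End RootsOfUnity.

(** * Evaluations *)

Section Evaluation.
Variable p : nat.
Hypothesis p_prime : prime p.
Hypothesis p_odd : odd p.

Let p0 := natr_prime_neq0 p_prime.

Let central (m : algC) := \sum_(1 <= k < p) 'C(2 * k, k)%:R / (k%:R * m ^+ k).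

Lemma lqN1 : lq p (-1) (-1) = 0.
Proof. by rewrite lqN // lq1. Qed.

(** * The field of the square root of 5: m = -1, 5, -5 *)

Section Golden.
Variables (s : algC) (e : int).
Hypothesis p5 : coprime p 5.
Hypothesis sP : sqrt_lift p 5 s e.

Let phi : algC := (1 + s) / 2.
Let psi : algC := (1 - s) / 2.
Let phi' : algC := (1 + e%:~R * s) / 2.
Let psi' : algC := (1 - e%:~R * s) / 2.
Let u := lq p phi phi'.
Let v := lq p psi psi'.

Let sD : s ^+ 2 = 5. Proof. by case: sP. Qed.
Let he : e = 1 \/ e = -1. Proof. by case: sP. Qed.
Let fphi : flift p phi phi'. Proof. exact: golden_flift. Qed.
Let fpsi : flift p psi psi'.
Proof. by have := golden_flift p_prime p_odd (sqrt_liftN p_odd sP); rewrite mulrN. Qed.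
Let fs : flift p s (e%:~R * s). Proof. exact: sqrt_flift sP. Qed.

(** Binet's formula at index p - e. When e = -1 the factor [phi * psi] = -1 of [conj_pow_sub]
    supplies the sign e. *)
Lemma fib_quot : 5 * ((fib `|p%:Z - e|%N)%:R / p%:R) = e%:~R * s * (u - v).
Proof.
have phi0 : phi != 0.
  apply/negP=> /eqP E; have : phi * psi = -1 by rewrite /phi /psi; field: sD.
  by rewrite E mul0r => /eqP; rewrite eq_sym oppr_eq0 oner_eq0.
have psi0 : psi != 0.
  apply/negP=> /eqP E; have : phi * psi = -1 by rewrite /phi /psi; field: sD.
  by rewrite E mulr0 => /eqP; rewrite eq_sym oppr_eq0 oner_eq0.
have H : (e = 1 /\ phi' = phi /\ psi' = psi) \/ (e = -1 /\ phi' = psi /\ psi' = phi).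
  by rewrite /phi' /psi' /phi /psi; case: he => ->; [left | right]; rewrite ?mul1r ?mulN1r ?opprK.
have := conj_pow_sub p_prime p_odd fphi fpsi phi0 psi0 H.
rewrite -/u -/v /phi /psi -fibE // -sD; move: (fib _)%:R => F E.
have -> : s ^+ 2 * (F / p%:R) = s * (s * F) / p%:R by field.
by rewrite E; case: he => -> /=; field: sD; rewrite p0.
Qed.

(** The roots of X^2 + X - 1 are [- phi] and [- psi], and the quotient of -1 is 0. *)
Lemma central_m1 : cong p (central (-1)) (- 5 * ((fib `|p%:Z - e|%N)%:R / p%:R)).
Proof.
have f1 : flift p (-1) (-1) by apply: fliftN => //; apply: (flift_nat p_prime (coprimen1 p)).
have := central_binomial_lq p_prime p_odd f1 (fliftN p_odd fphi) (fliftN p_odd fpsi).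
rewrite !lqN // lq1 -/u -/v mulNr fib_quot => H.
apply: cong_trans (H _ _ _ _) _.
- by rewrite /phi /psi; field.
- by rewrite /phi /psi; field: sD.
- by rewrite /phi' /psi'; field.
- by rewrite /phi' /psi'; case: he => ->; field: sD.
have -> : 0 - (- phi' - - psi') / -1 * (u - v) = - (e%:~R * s * (u - v)).
  by rewrite /phi' /psi'; field.
exact: cong_refl.
Qed.

(** The roots of X^2 - 5 X + 5 are [s * phi] and [- s * psi]; s and -s have equal quotients, so only
    u - v survives. *)
Lemma central_5 : cong p (central 5) (lq p 5 5 - (fib `|p%:Z - e|%N)%:R / p%:R).
Proof.
have f5 := flift_nat p_prime p5; have [n0 _ nV _] := f5.
have fa := fliftM p_prime fs fphi.
have fb := fliftM p_prime (fliftN p_odd fs) fpsi.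
apply: cong_trans (central_binomial_lq p_prime p_odd f5 fa fb _ _ _ _) _.
- by rewrite /phi /psi; field: sD.
- by rewrite /phi /psi; field: sD.
- by rewrite /phi' /psi'; case: he => ->; field: sD.
- by rewrite /phi' /psi'; case: he => ->; field: sD.
apply: congB; first exact: cong_refl.
have -> : (fib `|p%:Z - e|%N)%:R / p%:R = e%:~R * s / 5 * (u - v).
  by apply: (mulfI n0); rewrite fib_quot; field.
have -> : e%:~R * s * phi' - - (e%:~R * s) * psi' = e%:~R * s.
  by rewrite /phi' /psi'; field.
apply: congMl; first by apply: pintM => //; case: fs.
have -> : u - v = (lq p s (e%:~R * s) + u) - (lq p (-s) (- (e%:~R * s)) + v).
  by rewrite lqN //; ring.
apply: congB; apply: flift_lqM => //; exact: fliftN.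
Qed.

(** The roots of X^2 + 5 X - 5 are -s phi^2 and s psi^2. The squares double u - v, and the
    coefficient is 3 e s / 5; together they make the 6. *)
Lemma central_m5 : cong p (central (-5)) (lq p 5 5 - 6 * ((fib `|p%:Z - e|%N)%:R / p%:R)).
Proof.
have f5 := flift_nat p_prime p5; have [n0 _ nV _] := f5.
have fa := fliftM p_prime (fliftN p_odd fs) (fliftM p_prime fphi fphi).
have fb := fliftM p_prime fs (fliftM p_prime fpsi fpsi).
apply: cong_trans (central_binomial_lq p_prime p_odd (fliftN p_odd f5) fa fb _ _ _ _) _.
- by rewrite /phi /psi; field: sD.
- by rewrite /phi /psi; field: sD.
- by rewrite /phi' /psi'; case: he => ->; field: sD.
- by rewrite /phi' /psi'; case: he => ->; field: sD.
rewrite lqN //; apply: congB; first exact: cong_refl.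
have -> : 6 * ((fib `|p%:Z - e|%N)%:R / p%:R) = 3 * (e%:~R * s) / 5 * ((u + u) - (v + v)).
  by apply: (mulfI n0); rewrite mulrCA fib_quot; field.
have -> : (- (e%:~R * s) * (phi' * phi') - e%:~R * s * (psi' * psi')) / (- 5%:R) =
    3 * (e%:~R * s) / 5.
  by rewrite /phi' /psi'; case: he => ->; field: sD.
apply: congMl.
  by apply: pintM => //; apply: pintM; [exact: (pint_nat p 3) | case: fs].
have -> : u + u - (v + v) = (lq p (-s) (- (e%:~R * s)) + (u + u)) - (lq p s (e%:~R * s) + (v + v)).
  by rewrite lqN //; ring.
have twice x y z w : flift p x y -> flift p z w ->
    cong p (lq p (x * (z * z)) (y * (w * w))) (lq p x y + (lq p z w + lq p z w)).
  move=> fx fz; apply: cong_trans (flift_lqM p_prime fx (fliftM p_prime fz fz)) _.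
  by apply: congD; [exact: cong_refl | exact: flift_lqM].
by apply: congB; apply: twice => //; exact: fliftN.
Qed.

End Golden.

(** * The field of the square root of 2: m = -4 and the quarter sum *)

Section Silver.
Variables (s : algC) (e : int).
Hypothesis sP : sqrt_lift p 2 s e.

Let u := lq p (1 + s) (1 + e%:~R * s).
Let v := lq p (1 - s) (1 - e%:~R * s).

Let sD : s ^+ 2 = 2. Proof. by case: sP. Qed.
Let he : e = 1 \/ e = -1. Proof. by case: sP. Qed.
Let c2 : coprime p 2. Proof. exact: coprime_p2. Qed.
Let fu : flift p (1 + s) (1 + e%:~R * s). Proof. exact: silver_flift. Qed.
Let fv : flift p (1 - s) (1 - e%:~R * s).
Proof. by have := silver_flift p_prime (sqrt_liftN p_odd sP); rewrite mulrN. Qed.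
Let fs : flift p s (e%:~R * s). Proof. exact: sqrt_flift sP. Qed.
Let f2 : flift p 2 2. Proof. exact: flift_nat. Qed.

Lemma pell_quot : 4 * ((pell `|p%:Z - e|%N)%:R / p%:R) = e%:~R * s * (u - v).
Proof.
have E : (1 + s) * (1 - s) = -1 by ring: sD.
have u0 : 1 + s != 0.
  by apply/negP=> /eqP E0; move/eqP: E; rewrite E0 mul0r eq_sym oppr_eq0 oner_eq0.
have v0 : 1 - s != 0.
  by apply/negP=> /eqP E0; move/eqP: E; rewrite E0 mulr0 eq_sym oppr_eq0 oner_eq0.
have H : (e = 1 /\ 1 + e%:~R * s = 1 + s /\ 1 - e%:~R * s = 1 - s) \/
    (e = -1 /\ 1 + e%:~R * s = 1 - s /\ 1 - e%:~R * s = 1 + s).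
  by case: he => ->; [left | right]; rewrite ?mul1r ?mulN1r ?opprK.
have := conj_pow_sub p_prime p_odd fu fv u0 v0 H.
rewrite -/u -/v -pellE //; move: (pell _)%:R => F E1.
have -> : 4 * (F / p%:R) = s * (2 * s * F) / p%:R by field: sD; rewrite p0.
by rewrite E1 E; case: he => -> /=; field; rewrite p0.
Qed.

(** The roots of X^2 + 4 X - 4 are -2 (1 + s) and -2 (1 - s). *)
Lemma central_m4 :
  cong p (central (-4)) (2 * lq p 2 2 - 4 * ((pell `|p%:Z - e|%N)%:R / p%:R)).
Proof.
have E4 : 4 = 2 * 2 :> algC by ring.
have f4 : flift p 4 4 by rewrite E4; apply: fliftM.
have fa := fliftN p_odd (fliftM p_prime f2 fu).
have fb := fliftN p_odd (fliftM p_prime f2 fv).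
have n0 := flift_neq0 f4.
apply: cong_trans (central_binomial_lq p_prime p_odd (fliftN p_odd f4) fa fb _ _ _ _) _.
- by ring.
- by ring: sD.
- by ring.
- by case: he => ->; ring: sD.
rewrite !lqN //; apply: congB.
  have -> : 2 * lq p 2 2 = lq p 2 2 + lq p 2 2 by ring.
  by rewrite E4; apply: flift_lqM.
have -> : (- (2 * (1 + e%:~R * s)) - - (2 * (1 - e%:~R * s))) / (- 4%:R) = e%:~R * s by field.
rewrite pell_quot; apply: congMl; first by case: fs.
have -> : u - v = (lq p 2 2 + u) - (lq p 2 2 + v) by ring.
by apply: congB; apply: flift_lqM.
Qed.

(** 2 + s = s (1 + s) and 2 - s = -s (1 - s). The quotient of s is half that of 2, and u + v is
    congruent to 0 because the norm of 1 + s is -1. *)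
Lemma silver_pair : cong p
  ((2 + e%:~R * s) / 2 * lq p (2 + s) (2 + e%:~R * s) +
   (2 - e%:~R * s) / 2 * lq p (2 - s) (2 - e%:~R * s))
  (lq p 2 2 + 2 * ((pell `|p%:Z - e|%N)%:R / p%:R)).
Proof.
have [n0 _ nV _] := f2.
have -> : 2 * ((pell `|p%:Z - e|%N)%:R / p%:R) = e%:~R * s / 2 * (u - v).
  transitivity (e%:~R * s * (u - v) / 2); last by field.
  by rewrite -pell_quot; field.
have H1 := flift_lqM p_prime fs fu.
have H2 := flift_lqM p_prime (fliftN p_odd fs) fv.
have H3 := flift_lqM p_prime fs fs.
have H4 := flift_lqM p_prime fu fv.
rewrite -/u -/v in H1 H2 H4; rewrite lqN // in H2.
have ee : e%:~R * s * (e%:~R * s) = 2 by case: he => ->; ring: sD.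
have E1 : s * (1 + s) = 2 + s by ring: sD.
have E1' : e%:~R * s * (1 + e%:~R * s) = 2 + e%:~R * s by ring: ee.
have E2 : - s * (1 - s) = 2 - s by ring: sD.
have E2' : - (e%:~R * s) * (1 - e%:~R * s) = 2 - e%:~R * s by ring: ee.
have E4 : (1 + s) * (1 - s) = -1 by ring: sD.
have E4' : (1 + e%:~R * s) * (1 - e%:~R * s) = -1 by ring: ee.
rewrite E1 E1' in H1; rewrite E2 E2' in H2; rewrite ee -expr2 sD in H3.
rewrite E4 E4' lqN1 in H4.
case/(congP p_prime): H1 => e1 pe1 ->; case/(congP p_prime): H2 => e2 pe2 ->.
case/(congP p_prime): H3 => e3 pe3 ->; case/(congP p_prime): H4 => e4 pe4 H4.
have -> : v = - u - p%:R * e4.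
  by transitivity ((u + v + p%:R * e4) - u - p%:R * e4); [ring | rewrite -H4; ring].
apply/(congP p_prime); exists (e1 + e2 - e3 - e4 + e%:~R * s / 2 * (e1 - e2)); last by field.
have [_ ps _ _] := fs.
by apply: pintD; [repeat apply: pintB | apply: pintM; [apply: pintM | apply: pintB]] => //;
  apply: pintD.
Qed.

End Silver.

(** * The field of the square root of 3: m = -2, 6 and the sixth sum *)

Section Eta.
Variables (s : algC) (e : int).
Hypothesis c3 : coprime p 3.
Hypothesis sP : sqrt_lift p 3 s e.

Let u := lq p (1 + s) (1 + e%:~R * s).
Let v := lq p (1 - s) (1 - e%:~R * s).

Let sD : s ^+ 2 = 3. Proof. by case: sP. Qed.
Let he : e = 1 \/ e = -1. Proof. by case: sP. Qed.
Let c2 : coprime p 2. Proof. exact: coprime_p2. Qed.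
Let fu : flift p (1 + s) (1 + e%:~R * s). Proof. exact: eta_flift. Qed.
Let fv : flift p (1 - s) (1 - e%:~R * s).
Proof. by have := eta_flift p_prime p_odd (sqrt_liftN p_odd sP); rewrite mulrN. Qed.
Let fs : flift p s (e%:~R * s). Proof. exact: sqrt_flift sP. Qed.
Let f2 : flift p 2 2. Proof. exact: flift_nat. Qed.
Let f3 : flift p 3 3. Proof. exact: flift_nat. Qed.

(** Here [j] stands for the Legendre symbol of 2: the power of 2 in [seqSE] reduces to
    2^((p-1)/2). *)
Lemma seqS_quot (j : algC) : cong p (2 ^+ p.-1./2) j ->
  cong p (6 * j * ((seqS (`|p%:Z - e|%N %/ 2)%N)%:~R / p%:R)) (e%:~R * s * (u - v)).
Proof.
move=> hj.
have E : (1 + s) * (1 - s) = -2 by ring: sD.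
have n0 := flift_neq0 f2; have n3 := flift_neq0 f3.
have u0 : 1 + s != 0.
  by apply/negP=> /eqP E0; move/eqP: E; rewrite E0 mul0r eq_sym oppr_eq0 (negbTE n0).
have v0 : 1 - s != 0.
  by apply/negP=> /eqP E0; move/eqP: E; rewrite E0 mulr0 eq_sym oppr_eq0 (negbTE n0).
have H : (e = 1 /\ 1 + e%:~R * s = 1 + s /\ 1 - e%:~R * s = 1 - s) \/
    (e = -1 /\ 1 + e%:~R * s = 1 - s /\ 1 - e%:~R * s = 1 + s).
  by case: he => ->; [left | right]; rewrite ?mul1r ?mulN1r ?opprK.
have := conj_pow_sub p_prime p_odd fu fv u0 v0 H; rewrite -/u -/v E.
set N := `|p%:Z - e|%N.
have NE : N = (2 * (N %/ 2))%N by rewrite /N; case: he => ->; lia.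
rewrite {1 2}NE -seqSE // => E1.
have p1 := prime_gt1 p_prime.
set S := (seqS _)%:~R in E1 *.
have E2 : 6 * 2 ^+ p.-1./2 * (S / p%:R) = e%:~R * s * (u - v).
  have -> : 6 * 2 ^+ p.-1./2 * (S / p%:R) = s * (2 ^+ p.-1./2 * (2 * s) * S) / p%:R.
    by field: sD; rewrite p0.
  case: he => e1; rewrite {}e1 /= in N NE S E1 *.
    by rewrite (_ : p.-1./2 = N %/ 2)%N ?E1; [field; rewrite p0 | rewrite /N; lia].
  (* For e = -1 the power of 2 has one more factor 2, which cancels against the norm -2 and leaves a
     sign. *)
  have E3 : (N %/ 2)%N = p.-1./2.+1 by rewrite /N; lia.
  move: E1; rewrite {1}E3 exprS; move: (2 ^+ _) => t E1.
  have -> : t * (2 * s) * S = - (p%:R * (u - v)).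
    apply: (mulfI n0); transitivity (2 * t * (2 * s) * S); first by ring.
    by rewrite E1; ring.
  by field; rewrite p0.
rewrite -E2; apply: cong_sym.
have -> : 6 * 2 ^+ p.-1./2 * (S / p%:R) = (6 * (S / p%:R)) * 2 ^+ p.-1./2 by ring.
have -> : 6 * j * (S / p%:R) = (6 * (S / p%:R)) * j by ring.
apply: congMl => //.
(* Replacing 2^((p-1)/2) by [j] requires 6 S / p to be integral, which the exact identity [E2]
   shows. *)
have -> : 6 * (S / p%:R) = e%:~R * s * (u - v) * (2^-1) ^+ p.-1./2.
  by rewrite -E2 exprVn; field; rewrite p0 expf_neq0.
apply: pintM; last by apply: pintX; case: f2.
apply: pintM; first by case: fs.
by apply: pintB; apply: flift_lq_pint.
Qed.

Lemma eta_norm : cong p (lq p 2 2) (u + v).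
Proof.
have := flift_lqM p_prime fu fv.
have -> : (1 + s) * (1 - s) = -2 by ring: sD.
have -> : (1 + e%:~R * s) * (1 - e%:~R * s) = -2 by case: he => ->; ring: sD.
by rewrite lqN.
Qed.

(** The roots of X^2 + 2 X - 2 are -(1 + s) and -(1 - s). *)
Lemma central_m2 : cong p (central (-2)) (lq p 2 2 - e%:~R * s * (u - v)).
Proof.
have n0 := flift_neq0 f2.
apply: cong_trans (central_binomial_lq p_prime p_odd (fliftN p_odd f2)
  (fliftN p_odd fu) (fliftN p_odd fv) _ _ _ _) _.
- by ring.
- by ring: sD.
- by ring.
- by case: he => ->; ring: sD.
rewrite !lqN // -/u -/v.
have -> : (- (1 + e%:~R * s) - - (1 - e%:~R * s)) / (- 2%:R) = e%:~R * s by field.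
exact: cong_refl.
Qed.

(** The roots of X^2 - 6 X + 6 are s (1 + s) = 3 + s and -s (1 - s) = 3 - s. *)
Lemma central_6 : cong p (central 6) (lq p 2 2 + lq p 3 3 - e%:~R * s * (u - v) / 3).
Proof.
have E6 : 6 = 2 * 3 :> algC by ring.
have f6 : flift p 6 6 by rewrite E6; apply: fliftM.
have n0 := flift_neq0 f6; have n3 := flift_neq0 f3.
apply: cong_trans (central_binomial_lq p_prime p_odd f6
  (fliftM p_prime fs fu) (fliftM p_prime (fliftN p_odd fs) fv) _ _ _ _) _.
- by ring: sD.
- by ring: sD.
- by case: he => ->; ring: sD.
- by case: he => ->; ring: sD.
apply: congB; first by rewrite E6; apply: flift_lqM.
have -> : (e%:~R * s * (1 + e%:~R * s) - - (e%:~R * s) * (1 - e%:~R * s)) / 6 = e%:~R * s / 3.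
  by field.
have -> : e%:~R * s * (u - v) / 3 = e%:~R * s / 3 * (u - v) by field.
apply: congMl; first by apply: pintM; [case: fs | case: f3].
have -> : u - v = (lq p s (e%:~R * s) + u) - (lq p (-s) (- (e%:~R * s)) + v).
  by rewrite lqN //; ring.
by apply: congB; apply: flift_lqM => //; exact: fliftN.
Qed.

(** From (1 + s)^2 = 2 (2 + s), the quotient of 2 + s is 2u minus that of 2, hence u - v by
    [eta_norm]; that of 2 - s is v - u. *)
Lemma eta_pair : cong p
  ((2 + e%:~R * s) / 2 * lq p (2 + s) (2 + e%:~R * s) +
   (2 - e%:~R * s) / 2 * lq p (2 - s) (2 - e%:~R * s))
  (e%:~R * s * (u - v)).
Proof.
have [n0 _ nV _] := f2.
have ee : e%:~R * s * (e%:~R * s) = 3 by case: he => ->; ring: sD.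
have fw := omega_flift p_prime sP.
have fw' := omega_flift p_prime (sqrt_liftN p_odd sP); rewrite mulrN in fw'.
have H1 := flift_lqM p_prime f2 fw.
have H2 := flift_lqM p_prime f2 fw'.
have H3 := flift_lqM p_prime fu fu.
have H4 := flift_lqM p_prime fv fv.
have E1 : (1 + s) * (1 + s) = 2 * (2 + s) by ring: sD.
have E1' : (1 + e%:~R * s) * (1 + e%:~R * s) = 2 * (2 + e%:~R * s) by ring: ee.
have E2 : (1 - s) * (1 - s) = 2 * (2 - s) by ring: sD.
have E2' : (1 - e%:~R * s) * (1 - e%:~R * s) = 2 * (2 - e%:~R * s) by ring: ee.
rewrite E1 E1' in H3; rewrite E2 E2' in H4.
case/(congP p_prime): (cong_trans (cong_sym H1) H3) => e1 pe1; rewrite -/u => F1.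
case/(congP p_prime): (cong_trans (cong_sym H2) H4) => e2 pe2; rewrite -/v => F2.
case/(congP p_prime): eta_norm => e3 pe3 F3.
have -> : lq p (2 + s) (2 + e%:~R * s) = u + u + p%:R * e1 - lq p 2 2 by rewrite -F1; ring.
have -> : lq p (2 - s) (2 - e%:~R * s) = v + v + p%:R * e2 - lq p 2 2 by rewrite -F2; ring.
rewrite F3; apply/(congP p_prime).
exists (e1 + e2 - e3 - e3 + e%:~R * s / 2 * (e1 - e2)); last by field.
have [_ ps _ _] := fs.
by apply: pintD; [repeat apply: pintB | apply: pintM; [apply: pintM | apply: pintB]] => //;
  apply: pintD.
Qed.

End Eta.
End Evaluation.

(** * Harmonic sums in terms of units, and descent to the rationals *)

Section Assembly.
Variable p : nat.
Hypothesis p_prime : prime p.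
Hypothesis p_odd : odd p.

Let p0 := natr_prime_neq0 p_prime.

Lemma silver2_flift s e : sqrt_lift p 2 s e -> flift p (2 + s) (2 + e%:~R * s).
Proof.
move=> sP; have fs := sqrt_flift p_prime (coprime_p2 p_odd) sP.
have := fliftM p_prime fs (silver_flift p_prime sP).
case: sP => sD _ he _.
have -> : s * (1 + s) = 2 + s by ring: sD.
by have -> : e%:~R * s * (1 + e%:~R * s) = 2 + e%:~R * s by case: he => ->; ring: sD.
Qed.

(** Covers both the pair z, 1/z and its opposite, whose traces are s and -s, with the same sign
    e. *)
Lemma opp_root_pair_quot n (z x : algC) (e : int) : n.-primitive_root z ->
  x = z \/ x = - z ->
  z ^+ p + z ^- p = e%:~R * (z + z^-1) ->
  flift p (2 + (x + x^-1)) (2 + e%:~R * (x + x^-1)) ->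
  cong p (((1 + x) ^+ p + (1 + x^-1) ^+ p - (2 + e%:~R * (x + x^-1))) / p%:R)
    ((2 + e%:~R * (x + x^-1)) / 2 * lq p (2 + (x + x^-1)) (2 + e%:~R * (x + x^-1))).
Proof.
move=> zP hx E.
have z0 := prim_root_neq0 zP.
have x0 : x != 0 by case: hx => ->; rewrite ?oppr_eq0.
have pz : pint p z by have := pint_prim_root p 1 zP; rewrite expr1.
have pzV := pint_prim_rootV p zP.
have px : pint p x by case: hx => -> //; apply: pintN.
have pxV : pint p x^-1 by case: hx => -> //; rewrite invrN; apply: pintN.
have <- : x ^+ p + x ^- p = e%:~R * (x + x^-1).
  case: hx => -> //; rewrite exprNn -signr_odd p_odd expr1 mulN1r !invrN.
  by rewrite -!opprD mulrN E.
exact: pair_root_quot.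
Qed.

Lemma quarter_sum z (e : int) : 8.-primitive_root z -> sqrt_lift p 2 (z + z^-1) e ->
  z ^+ p + z ^- p = e%:~R * (z + z^-1) ->
  cong p (\sum_(1 <= k < p | (4 * k < 3 * p)%N) (-1) ^+ k.-1 / k%:R)
    (lq p 2 2 - 2 * ((pell `|p%:Z - e|%N)%:R / p%:R)).
Proof.
move=> zP sP sE.
have z0 := prim_root_neq0 zP.
have d4 : ~~ (4 %| p)%N by apply/negP => /dvdn_odd; rewrite p_odd => /(_ isT).
apply: cong_trans (sum_reflect p_prime p_odd d4 _) _ => //.
have -> : lq p 2 2 - 2 * ((pell `|p%:Z - e|%N)%:R / p%:R) =
  2 * lq p 2 2 - (lq p 2 2 + 2 * ((pell `|p%:Z - e|%N)%:R / p%:R)) by ring.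
apply: congB; first exact/cong_sym/sum_expr2_quot.
apply: cong_trans (cong_sym (sum_root_quot p_prime p_odd _ _ d4 zP)) _ => //.
apply: cong_trans _ (silver_pair p_prime p_odd sP).
have H1 := opp_root_pair_quot zP (or_introl erefl) sE (silver2_flift sP).
have H2 := opp_root_pair_quot zP (or_intror erefl) sE.
rewrite invrN -opprD mulrN in H2.
have {}H2 := H2 (_ : flift p (2 - (z + z^-1)) (2 - e%:~R * (z + z^-1))).
have f2 : flift p (2 - (z + z^-1)) (2 - e%:~R * (z + z^-1)).
  by have := silver2_flift (sqrt_liftN p_odd sP); rewrite mulrN.
apply: cong_trans _ (congD H1 (H2 f2)).
have z4 : z ^+ 4 = -1 by apply: (prim_root_half _ (zP : (2 * 4).-primitive_root z)).
(* The roots of x^4 = -1 are z, 1/z, -z, -1/z, grouped as two inverse pairs. *)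
have z3 : z ^+ 3 = - z^-1 by apply: (mulfI z0); rewrite -exprS z4 mulrN mulfV.
have z5 : z ^+ 5 = - z by rewrite exprS z4 mulrN1.
have z7 : z ^+ 7 = z^-1 by rewrite (exprD z 4 3) z4 z3 mulN1r opprK.
rewrite !big_ord_recr big_ord0 /= add0r expr1 z3 z5 z7.
set a := _ ^+ p; set b := _ ^+ p; set c := _ ^+ p; set d := _ ^+ p.
by rewrite (_ : _ / _ = (a + d - (2 + e%:~R * (z + z^-1))) / p%:R
   + (c + b - (2 - e%:~R * (z + z^-1))) / p%:R); [exact: cong_refl | field; rewrite p0].
Qed.

Lemma sixth_sum z (e : int) : (3 < p)%N -> 12.-primitive_root z -> sqrt_lift p 3 (z + z^-1) e ->
  z ^+ p + z ^- p = e%:~R * (z + z^-1) ->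
  cong p (\sum_(1 <= k < p | (6 * k < 5 * p)%N) (-1) ^+ k.-1 / k%:R)
    (lq p 2 2 - e%:~R * (z + z^-1) * (lq p (1 + (z + z^-1)) (1 + e%:~R * (z + z^-1))
       - lq p (1 - (z + z^-1)) (1 - e%:~R * (z + z^-1)))).
Proof.
move=> p3 zP sP sE.
have z0 := prim_root_neq0 zP.
have c3 : coprime p 3 by rewrite prime_coprime // gtnNdvd.
have d6 : ~~ (6 %| p)%N by apply/negP => /dvdn_odd; rewrite p_odd => /(_ isT).
apply: cong_trans (sum_reflect p_prime p_odd d6 _) _ => //.
set t := e%:~R * _ * _.
have -> : lq p 2 2 - t = 2 * lq p 2 2 - (lq p 2 2 + t) by ring.
apply: congB; first exact/cong_sym/sum_expr2_quot.
apply: cong_trans (cong_sym (sum_root_quot p_prime p_odd _ _ d6 zP)) _ => //.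
have f2 := flift_nat p_prime (coprime_p2 p_odd).
have z6 : z ^+ 6 = -1 by apply: (prim_root_half _ (zP : (2 * 6).-primitive_root z)).
(* z^3 is a square root of -1, so the pair z^3, z^9 has trace 0 and contributes the quotient of 2;
   the other four roots are z, 1/z, -z, -1/z. *)
have i2 : (z ^+ 3) ^- 1 = - z ^+ 3.
  have i0 : z ^+ 3 != 0 by rewrite expf_neq0.
  by rewrite expr1; apply: (mulfI i0); rewrite mulfV // mulrN -exprD z6 opprK.
rewrite expr1 in i2.
have H1 := opp_root_pair_quot zP (or_introl erefl) sE (omega_flift p_prime sP).
have H2 := opp_root_pair_quot zP (or_intror erefl) sE.
rewrite invrN -opprD mulrN in H2.
have fo : flift p (2 - (z + z^-1)) (2 - e%:~R * (z + z^-1)).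
  by have := omega_flift p_prime (sqrt_liftN p_odd sP); rewrite mulrN.
have {}H2 := H2 fo.
have H3 : cong p (((1 + z ^+ 3) ^+ p + (1 - z ^+ 3) ^+ p - 2) / p%:R) (lq p 2 2).
  have := @pair_root_quot p p_prime p_odd (z ^+ 3); cbv zeta.
  have -> : (z ^+ 3) ^- p = - (z ^+ 3) ^+ p.
    by rewrite -exprVn i2 exprNn -signr_odd p_odd expr1 mulN1r.
  rewrite i2 !subrr addr0 divff ?mul1r; last by case: f2.
  apply => //; first by rewrite expf_neq0.
    exact: pint_prim_root zP.
  exact/pintN/(pint_prim_root _ _ zP).
have := eta_pair p_prime p_odd c3 sP; rewrite -/t => Ht.
apply: cong_trans _ (congD (cong_refl p (lq p 2 2)) Ht).
apply: cong_trans _ (congD H3 (congD H1 H2)).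
have z5 : z ^+ 5 = - z^-1 by apply: (mulfI z0); rewrite -exprS z6 mulrN mulfV.
have z7 : z ^+ 7 = - z by rewrite exprS z6 mulrN1.
have z9 : z ^+ 9 = - z ^+ 3 by rewrite (exprD z 6 3) z6 mulN1r.
have z11 : z ^+ 11 = z^-1 by rewrite (exprD z 6 5) z6 z5 mulN1r opprK.
rewrite !big_ord_recr big_ord0 /= add0r expr1 z5 z7 z9 z11.
set a := _ ^+ p; set b := _ ^+ p; set c := _ ^+ p.
set d := _ ^+ p; set f := _ ^+ p; set g := _ ^+ p.
by rewrite (_ : _ / _ = (b + f - 2) / p%:R + ((a + g - (2 + e%:~R * (z + z^-1))) / p%:R
   + (d + c - (2 - e%:~R * (z + z^-1))) / p%:R)); [exact: cong_refl | field; rewrite p0].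
Qed.

Lemma pint_central m : pint p m^-1 ->
  pint p (\sum_(1 <= k < p) 'C(2 * k, k)%:R / (k%:R * m ^+ k)).
Proof.
move=> pm; apply: pint_sum => k; rewrite mem_index_iota => kp _.
rewrite invfM -exprVn; apply: pintM; first exact: pint_nat.
by apply: pintM; [exact: pintV_small | exact: pintX].
Qed.

Lemma pint_harmonic (P : pred nat) : pint p (\sum_(1 <= k < p | P k) (-1) ^+ k.-1 / k%:R).
Proof.
apply: pint_sum => k; rewrite mem_index_iota => kp _.
by apply: pintM; [exact/pintX/pintN/pint1 | exact: pintV_small].
Qed.

Lemma ratr_fermat_quotient (a : nat) : (0 < a)%N -> ratr (fermat_quotient p a) = lq p a%:R a%:R.
Proof.
move=> a0; have a0' : a%:R != 0 :> algC by rewrite pnatr_eq0 -lt0n.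
rewrite /fermat_quotient fmorph_div rmorphB rmorphXn /= ratr_int rmorph1 ratr_nat.
rewrite /lq -[in RHS](prednK (prime_gt0 p_prime)) exprS (prednK (prime_gt0 p_prime)).
by rewrite -pmulrn mulrAC mulfV // mul1r.
Qed.

Lemma ratr_central (m : nat) :
  ratr (\sum_(1 <= k < p) 'C(2 * k, k)%:R / (k%:R * m%:R ^+ k)) =
  \sum_(1 <= k < p) 'C(2 * k, k)%:R / (k%:R * m%:R ^+ k) :> algC.
Proof.
rewrite rmorph_sum /=; apply: eq_bigr => k _.
by rewrite fmorph_div rmorphM rmorphXn /= !ratr_nat.
Qed.

Lemma ratr_central_alt (m : nat) :
  ratr (\sum_(1 <= k < p) (-1) ^+ k * ('C(2 * k, k)%:R / (k%:R * m%:R ^+ k))) =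
  \sum_(1 <= k < p) 'C(2 * k, k)%:R / (k%:R * (- m%:R) ^+ k) :> algC.
Proof.
rewrite rmorph_sum /=; apply: eq_bigr => k _.
rewrite rmorphM fmorph_div rmorphM !rmorphXn rmorphN1 /= !ratr_nat.
rewrite (exprNn m%:R) !invfM invr_sign; ring.
Qed.

Lemma ratr_harmonic (P : pred nat) :
  ratr (\sum_(1 <= k < p | P k) (-1) ^+ k.-1 / k%:R) =
  \sum_(1 <= k < p | P k) (-1) ^+ k.-1 / k%:R :> algC.
Proof.
rewrite rmorph_sum /=; apply: eq_bigr => k _.
by rewrite fmorph_div rmorphXn rmorphN1 /= ratr_nat.
Qed.

Lemma ratcong_sym x y : ratcong p x y -> ratcong p y x.
Proof.
case=> px py [z pz E]; split=> //; exists (- z); last by rewrite mulrN -E opprB.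
by rewrite /pintegral denqN.
Qed.

(** s^p = s a^((p-1)/2), so Euler's criterion makes e congruent to the symbol; two signs congruent
    modulo p > 2 are equal. *)
Lemma sqrt_lift_sign a s e : coprime p a -> sqrt_lift p a s e -> e = jacobi a p.
Proof.
move=> ca [sD ps he H]; have [a0 _ aV _] := flift_nat p_prime ca.
have pa : ~~ (p %| a)%N by rewrite -prime_coprime.
rewrite jacobi_prime //; have [hl L] := legendreP p_prime p_odd pa.
have p1 := prime_gt1 p_prime.
have pE : (p = (2 * p.-1./2).+1)%N by lia.
have E1 : s / a%:R * s ^+ p = a%:R ^+ p.-1./2.
  rewrite {1}pE exprS exprM sD; transitivity (s ^+ 2 / a%:R * a%:R ^+ p.-1./2).
    by field.
  by rewrite sD divff // mul1r.
have E2 : s / a%:R * (e%:~R * s) = e%:~R.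
  transitivity (s ^+ 2 / a%:R * e%:~R); first by field.
  by rewrite sD divff // mul1r.
have := congMl (pintM ps aV) H; rewrite E1 E2 => H2.
have /(cong_int p_prime) := cong_trans (cong_sym L) H2.
by case: hl => ->; case: he => -> //; rewrite dvdzE => /dvdn_leq /=; lia.
Qed.

End Assembly.

(** * The congruences over the rationals *)

Theorem corollary1p3 (p : nat) (p_prime : prime p) (p_odd : odd p) :
  let F : rat := (fib `|p%:Z - jacobi p%:Z 5|%N)%:R / p%:R in
  let P : rat := (pell `|p%:Z - jacobi 2 p|%N)%:R / p%:R in
  let S : rat := (seqS (`|p%:Z - jacobi 3 p|%N %/ 2)%N)%:~R / p%:R in
  let q := fermat_quotient p in
  let j2p : rat := (jacobi 2 p)%:~R in
  [/\ (* (i) *)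
      p <> 5%N ->
      [/\ ratcong p
            (\sum_(1 <= k < p) (-1) ^+ k * ('C(2 * k, k)%:R / k%:R))
            (- 5%:R * F),
          ratcong p
            (\sum_(1 <= k < p)
               (-1) ^+ k * ('C(2 * k, k)%:R / (k%:R * 5%:R ^+ k)))
            (q 5 - 6%:R * F) &
          ratcong p
            (\sum_(1 <= k < p) 'C(2 * k, k)%:R / (k%:R * 5%:R ^+ k))
            (q 5 - F)],
      (* (ii) *)
      ratcong p
        (\sum_(1 <= k < p)
           (-1) ^+ k * ('C(2 * k, k)%:R / (k%:R * 4%:R ^+ k)))
        (2%:R * q 2 - 4%:R * P) /\
      ratcong p
        (2%:R * q 2 - 4%:R * P)
        (2%:R * \sum_(1 <= k < p | (4 * k < 3 * p)%N) (-1) ^+ k.-1 / k%:R) &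
      (* (iii) *)
      (3 < p)%N ->
      [/\ ratcong p
            (\sum_(1 <= k < p)
               (-1) ^+ k * ('C(2 * k, k)%:R / (k%:R * 2%:R ^+ k)))
            (q 2 - 6%:R * j2p * S),
          ratcong p
            (q 2 - 6%:R * j2p * S)
            (\sum_(1 <= k < p | (6 * k < 5 * p)%N) (-1) ^+ k.-1 / k%:R) &
          ratcong p
            (\sum_(1 <= k < p) 'C(2 * k, k)%:R / (k%:R * 6%:R ^+ k))
            (q 2 + q 3 - 2%:R * j2p * S)]].
Proof.
move=> F P S q j2p.
have p0 : p%:R != 0 :> algC by rewrite pnatr_eq0 -lt0n prime_gt0.
have c2 := coprime_p2 p_odd.
have pV n : coprime p n -> pint p (n%:R)^-1 by apply: pintVn.
have pVN n : coprime p n -> pint p (- n%:R)^-1 by move=> /pV; rewrite invrN; apply: pintN.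
have c4 : coprime p 4 by rewrite (@coprimeXr 2 p 2).
have ratrF : ratr F = (fib `|p%:Z - jacobi p%:Z 5|%N)%:R / p%:R :> algC.
  by rewrite fmorph_div /= !ratr_nat.
have ratrP : ratr P = (pell `|p%:Z - jacobi 2 p|%N)%:R / p%:R :> algC.
  by rewrite fmorph_div /= !ratr_nat.
have ratrS : ratr S = (seqS (`|p%:Z - jacobi 3 p|%N %/ 2)%N)%:~R / p%:R :> algC.
  by rewrite fmorph_div /= ratr_int ratr_nat.
have ratrq (a : nat) : (0 < a)%N -> ratr (q a) = lq p a%:R a%:R.
  exact: ratr_fermat_quotient.
have j2 : cong p (2 ^+ (p.-1)./2) (ratr j2p).
  rewrite ratr_int jacobi_prime //; apply: (proj2 (legendreP p_prime p_odd (_ : ~~ (p %| 2)%N))).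
  by rewrite -prime_coprime.
clearbody F P S q j2p.
split.
- move=> p5.
  have c5 : coprime p 5 by rewrite prime_coprime // dvdn_prime2 //; apply/eqP.
  have [z zP] := C_prim_root_exists (isT : (0 < 5)%N).
  (* The Gauss sum yields the sign (p/5) directly; for 2 and 3 below, the sign is identified by
     [sqrt_lift_sign]. *)
  have sP := root5_lift p_prime p_odd p5 zP.
  have sum_m1 : ratr (\sum_(1 <= k < p) (-1) ^+ k * ('C(2 * k, k)%:R / k%:R)) =
      \sum_(1 <= k < p) 'C(2 * k, k)%:R / (k%:R * (- 1) ^+ k) :> algC.
    rewrite -(ratr_central_alt p 1); congr ratr.
    by apply: eq_bigr => k _; rewrite expr1n mulr1.
  split; apply: cong_ratcong => //.
  + by rewrite sum_m1; apply: pint_central => //; exact: (pVN 1%N (coprimen1 p)).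
  + rewrite sum_m1 rmorphM rmorphN /= ratr_nat ratrF.
    exact: central_m1 sP.
  + by rewrite ratr_central_alt; apply: pint_central => //; apply: pVN.
  + rewrite ratr_central_alt rmorphB rmorphM /= ratr_nat ratrF ratrq //.
    exact: central_m5 sP.
  + by rewrite ratr_central; apply: pint_central => //; apply: pV.
  rewrite ratr_central rmorphB /= ratrF ratrq //.
  exact: central_5 sP.
- have [z zP] := C_prim_root_exists (isT : (0 < 8)%N).
  have [e sP sE] := root8_lift p_prime p_odd zP.
  rewrite -(sqrt_lift_sign p_prime p_odd c2 sP) in ratrP.
  split.
    apply: cong_ratcong => //.
      by rewrite ratr_central_alt; apply: pint_central => //; apply: pVN.
    rewrite ratr_central_alt rmorphB !rmorphM /= !ratr_nat ratrP ratrq //.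
    exact: central_m4 sP.
  (* Reversed because the harmonic sum is visibly integral, while P/p is not. *)
  apply: ratcong_sym; apply: cong_ratcong => //.
    rewrite rmorphM /= ratr_nat ratr_harmonic.
    by apply: pintM; [exact: pint_nat | exact: pint_harmonic].
  rewrite rmorphB !rmorphM /= !ratr_nat ratrP ratrq // ratr_harmonic.
  have := congMl (pint_nat p 2) (quarter_sum p_prime p_odd zP sP sE).
  by congr cong; ring.
move=> p3.
have c3 : coprime p 3 by rewrite prime_coprime // gtnNdvd.
have [z zP] := C_prim_root_exists (isT : (0 < 12)%N).
have [e sP sE] := root12_lift p_prime p_odd p3 zP.
rewrite -(sqrt_lift_sign p_prime p_odd c3 sP) in ratrS.
have HS := seqS_quot p_prime p_odd c3 sP j2.
split.
- apply: cong_ratcong => //.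
    by rewrite ratr_central_alt; apply: pint_central => //; apply: pVN.
  rewrite ratr_central_alt rmorphB !rmorphM /= !ratr_nat ratrS ratrq //.
  apply: cong_trans (central_m2 p_prime p_odd sP) _.
  by apply: congB; [exact: cong_refl | exact: cong_sym].
- apply: ratcong_sym; apply: cong_ratcong => //.
    by rewrite ratr_harmonic; exact: pint_harmonic.
  rewrite rmorphB !rmorphM /= !ratr_nat ratrS ratrq // ratr_harmonic.
  apply: cong_trans (sixth_sum p_prime p_odd p3 zP sP sE) _.
  by apply: congB; [exact: cong_refl | exact: cong_sym].
apply: cong_ratcong => //.
  rewrite ratr_central; apply: pint_central => //; apply: pV.
  by rewrite (coprimeMr p 2 3) c2.
rewrite ratr_central rmorphB rmorphD !rmorphM /= !ratr_nat ratrS !ratrq //.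
apply: cong_trans (central_6 p_prime p_odd c3 sP) _.
apply: congB; first exact: cong_refl.
(* A third of the relation [HS] turns the factor 6 of the previous congruences into 2. *)
have := congMl (pV 3 c3) (cong_sym HS).
by congr cong; field; rewrite ?p0 ?(prim_root_neq0 zP).
Qed.
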